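(* Fix probabilities $p_1,p_2,p_3>0$ with $p_1+p_2+p_3=1$. Let $U_1,U_2,U_3$ be independent Haar-random unitaries on $\mathbb{C}^2\otimes\mathbb{C}^2$ and set $|\psi_i\rangle=U_i|00\rangle$. Then with probability one, no LOCC measurement attains the optimal minimum-error success probability for the ensemble $\{|\psi_i\rangle,p_i\}_{i=1}^3$.
   Context: The optimal minimum-error success probability of an ensemble $\{|\psi_i\rangle,p_i\}_{i=1}^n$ is the maximum over all $n$-outcome POVMs $\{\Pi_i\}$ of $\sum_ip_i\langle\psi_i|\Pi_i|\psi_i\rangle$. LOCC means measurements implementable by local operations on each qubit and classical communication between the two parties. *)

(* Defs.v *)
From HB Require Import structures.
From mathcomp Require Import all_boot all_order all_algebra.
From mathcomp Require Import all_classical all_reals all_analysis.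
From mathcomp Require Import complex mxtens.

Set Implicit Arguments.
Unset Strict Implicit.
Unset Printing Implicit Defensive.

Import Order.TTheory GRing.Theory Num.Theory.
Local Open Scope classical_set_scope.
Local Open Scope ring_scope.

Section QuantumDefs.
Variable R : realType.
Local Notation C := (R[i]).

Definition adjmx (m n : nat) (A : 'M[C]_(m, n)) : 'M[C]_(n, m) :=
  (map_mx (@conjc R) A)^T.

Definition unitary (n : nat) (U : 'M[C]_n) : Prop := U *m adjmx U = 1%:M.

(** Positive semidefinite matrices: <v|A|v> >= 0 (real and nonnegative) for all v
    (together with hermiticity, which is implied over C but stated for clarity). *)
Definition psd (n : nat) (A : 'M[C]_n) : Prop :=
  adjmx A = A /\ forall v : 'cV[C]_n, 0 <= (adjmx v *m A *m v) 0 0.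

Definition povm (n k : nat) (Pi : 'I_k -> 'M[C]_n) : Prop :=
  (forall i, psd (Pi i)) /\ \sum_(i < k) Pi i = 1%:M.

Definition success (n k : nat) (p : 'I_k -> R) (psi : 'I_k -> 'cV[C]_n)
    (Pi : 'I_k -> 'M[C]_n) : C :=
  \sum_(i < k) real_complex R (p i) * (adjmx (psi i) *m Pi i *m psi i) 0 0.

Definition attains_optimum (n k : nat) (p : 'I_k -> R) (psi : 'I_k -> 'cV[C]_n)
    (Pi : 'I_k -> 'M[C]_n) : Prop :=
  povm Pi /\ forall Pi' : 'I_k -> 'M[C]_n, povm Pi' -> success p psi Pi' <= success p psi Pi.

(** Two-qubit space C^2 (x) C^2 = C^4 via the Kronecker product [tensmx];
    |00> is the first standard basis vector. *)
Definition ket00 : 'cV[C]_(2 * 2) := delta_mx 0 0.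

(** Finite-round LOCC protocols on two qubits with k final outcomes.
    At each node one party (A = first qubit, B = second qubit) performs a local
    measurement with finitely many Kraus operators (a local quantum instrument),
    broadcasts the outcome, and the protocol continues depending on it; at a leaf
    the final outcome is declared. *)
Inductive locc (k : nat) : Type :=
| LoccOut of 'I_k
| LoccA (m : nat) of ('I_m -> 'M[C]_2) & ('I_m -> locc k)
| LoccB (m : nat) of ('I_m -> 'M[C]_2) & ('I_m -> locc k).

Fixpoint locc_wf (k : nat) (t : locc k) : Prop :=
  match t with
  | LoccOut _ => True
  | LoccA m K next =>
      \sum_(j < m) adjmx (K j) *m K j = 1%:M /\ forall j, locc_wf (next j)
  | LoccB m K next =>
      \sum_(j < m) adjmx (K j) *m K j = 1%:M /\ forall j, locc_wf (next j)
  end.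

Fixpoint locc_povm (k : nat) (t : locc k) (o : 'I_k) : 'M[C]_(2 * 2) :=
  match t with
  | LoccOut o' => if o' == o then 1%:M else 0
  | LoccA m K next =>
      \sum_(j < m) adjmx (tensmx (K j) (1%:M : 'M[C]_2)) *m locc_povm (next j) o
                    *m tensmx (K j) (1%:M : 'M[C]_2)
  | LoccB m K next =>
      \sum_(j < m) adjmx (tensmx (1%:M : 'M[C]_2) (K j)) *m locc_povm (next j) o
                    *m tensmx (1%:M : 'M[C]_2) (K j)
  end.

Definition is_locc (k : nat) (Pi : 'I_k -> 'M[C]_(2 * 2)) : Prop :=
  exists t : locc k, locc_wf t /\ forall o, locc_povm t o = Pi o.

(** Measurable structure on 4x4 complex matrices: the Borel sigma-algebra of
    C^16 = R^32, generated by the real and imaginary parts of the entries. *)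
Definition mx_coord (k : 'I_32) (A : 'M[C]_(2 * 2)) : R :=
  let e := A (inord (k %/ 8)) (inord ((k %/ 2) %% 4)) in
  if odd k then complex.Im e else complex.Re e.

End QuantumDefs.

Definition mx44 (R : realType) := 'M[R[i]]_(2 * 2).
HB.instance Definition _ (R : realType) := Choice.on (mx44 R).
HB.instance Definition _ (R : realType) := isPointed.Build (mx44 R) 0.

Section QuantumDefs2.
Variable R : realType.
Local Notation C := (R[i]).

Definition CMat := g_sigma_algebraType (g_sigma_preimage (@mx_coord R : 'I_32 -> mx44 R -> R)).

(** Haar probability measure on U(4), viewed as a Borel probability measure on
    4x4 complex matrices concentrated on U(4) and invariant under left
    multiplication by unitaries (this characterizes the Haar measure uniquely). *)
Definition haar_measure (mu : probability CMat R) : Prop :=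
  mu [set U : CMat | unitary U] = 1%E /\
  forall (V : 'M[C]_(2 * 2)) (A : set CMat), unitary V -> measurable A ->
    mu [set (V *m U : CMat) | U in A] = mu A.

End QuantumDefs2.

(* Main.v *)
Require Import Defs.
From HB Require Import structures.
From mathcomp Require Import all_boot all_order all_algebra.
From mathcomp Require Import all_classical all_reals all_analysis.
From mathcomp Require Import complex mxtens.
From mathcomp Require Import ring spectral sesquilinear measurable_realfun.

Set Implicit Arguments.
Unset Strict Implicit.
Unset Printing Implicit Defensive.

Import Order.TTheory GRing.Theory Num.Theory.
Import numFieldNormedType.Exports.
Local Open Scope classical_set_scope.
Local Open Scope ring_scope.

Local Notation "A ^H" := (adjmx A) (at level 8, format "A ^H") : ring_scope.

(** Since the states are almost surely linearly independent, an optimal POVM [Pi] makes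
    [Lambda = sum_i p_i Pi_i |psi_i><psi_i|] Hermitian with [Lambda >= p_j |psi_j><psi_j|], and then the
    vectors [phi_i = Pi_i psi_i] are nonzero, pairwise orthogonal, perfectly discriminated by [Pi], and
    determined by the ensemble up to scalars.  If [Pi] is LOCC, follow the protocol to its first round
    whose Kraus operators are not all proportional to unitaries: orthogonality must survive it, which
    yields three pairwise orthogonal vectors of a 2-dimensional space and hence forces one of the
    [phi_i] to be a product vector.

    That this has probability zero follows from symmetry.  Left multiplication of the three unitaries by
    a common [T] maps each [phi_i] to a multiple of [T phi_i] and preserves the measure.  There are
    infinitely many unitaries [T_n] such that, for every nonzero [v], [T_n v] is a product vector for at
    most 13 values of [n] (a polynomial in a unit complex parameter).  So the translates of the bad set
    have the same measure and bounded overlap, and the measure must be 0.  The linear dependence of the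
    states is handled in the same way. *)

(** * Adjoints and positive semidefinite matrices *)

Section Adjoint.
Variable R : realType.
Local Notation C := (R[i]).

Lemma conjcE (x : C) : conjc x = x^*%R.
Proof. by []. Qed.

Lemma adjmxE m n (A : 'M[C]_(m, n)) i j : A^H i j = (A j i)^*.
Proof. by rewrite !mxE. Qed.

Lemma adjmxK m n (A : 'M[C]_(m, n)) : (A^H)^H = A.
Proof. by apply/matrixP => i j; rewrite !adjmxE conjCK. Qed.

Lemma adjmxD m n (A B : 'M[C]_(m, n)) : (A + B)^H = A^H + B^H.
Proof. by apply/matrixP => i j; rewrite !mxE rmorphD. Qed.

Lemma adjmxN m n (A : 'M[C]_(m, n)) : (- A)^H = - A^H.
Proof. by apply/matrixP => i j; rewrite !mxE rmorphN. Qed.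

Lemma adjmxB m n (A B : 'M[C]_(m, n)) : (A - B)^H = A^H - B^H.
Proof. by rewrite adjmxD adjmxN. Qed.

Lemma adjmxZ m n (a : C) (A : 'M[C]_(m, n)) : (a *: A)^H = a^* *: A^H.
Proof. by apply/matrixP => i j; rewrite !mxE rmorphM. Qed.

Lemma adjmx0 m n : (0 : 'M[C]_(m, n))^H = 0.
Proof. by apply/matrixP => i j; rewrite adjmxE !mxE conjC0. Qed.

Lemma adjmx1 n : (1%:M : 'M[C]_n)^H = 1%:M.
Proof. by apply/matrixP => i j; rewrite adjmxE !mxE eq_sym; case: eqP; rewrite ?conjC1 ?conjC0. Qed.

Lemma adjmxM m n q (A : 'M[C]_(m, n)) (B : 'M[C]_(n, q)) : (A *m B)^H = B^H *m A^H.
Proof.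
apply/matrixP => i j; rewrite adjmxE !mxE rmorph_sum; apply: eq_bigr => k _.
by rewrite ?mxE rmorphM mulrC.
Qed.

Lemma adjmx_sum m n (I : finType) (P : pred I) (F : I -> 'M[C]_(m, n)) :
  (\sum_(i | P i) F i)^H = \sum_(i | P i) (F i)^H.
Proof. exact: (big_morph _ (@adjmxD m n) (@adjmx0 m n)). Qed.

Lemma conj_real (x : R) : (real_complex R x)^* = real_complex R x :> C.
Proof. by rewrite -conjcE /= oppr0. Qed.

Lemma adjmx_trC m n (A : 'M[C]_(m, n)) : A^H = (map_mx (@Num.conj C) A^T).
Proof. by apply/matrixP => i j; rewrite adjmxE !mxE. Qed.

Lemma gram_ge0 n m (v : 'cV[C]_n) (A : 'M[C]_(m,n)): 0 <= (v^H *m (A^H *m A) *m v) 0 0.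
Proof.
have -> : v^H *m (A^H *m A) *m v = (A *m v)^H *m (A *m v) by rewrite adjmxM !mulmxA.
rewrite mxE sumr_ge0 // => k _; rewrite adjmxE mulrC; exact: mul_conjC_ge0.
Qed.

Lemma norm_eq0 n (v : 'cV[C]_n) : (v^H *m v) 0 0 = 0 -> v = 0.
Proof.
rewrite mxE => /eqP; rewrite psumr_eq0; last first.
  by move=> k _; rewrite adjmxE mulrC mul_conjC_ge0.
move=> /allP h; apply/matrixP => k j; rewrite ord1 mxE.
have := h k (mem_index_enum k); rewrite /= adjmxE mulrC => /eqP/eqP.
by rewrite mul_conjC_eq0 => /eqP.
Qed.

Lemma norm_ge0 n (v : 'cV[C]_n) : 0 <= (v^H *m v) 0 0.
Proof. by have := gram_ge0 v 1%:M; rewrite adjmx1 mulmx1 mulmx1. Qed.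

Lemma psd_gram n m (A : 'M[C]_(m, n)) : psd (A^H *m A).
Proof. by split; [rewrite adjmxM adjmxK|move=> v; exact: gram_ge0]. Qed.

Lemma form_delta n (G : 'M[C]_n) i :
  ((delta_mx i 0 : 'cV[C]_n)^H *m G *m (delta_mx i 0 : 'cV[C]_n)) 0 0 = G i i.
Proof.
rewrite -colE mxE mxE (bigD1 i) //= big1 ?addr0.
  by rewrite adjmxE !mxE !eqxx conjC1 mul1r.
by move=> k ki; rewrite adjmxE !mxE (negbTE ki) conjC0 mul0r.
Qed.

(** By the spectral theorem [G = S^H D S] with [D >= 0], and [sqrt(D) S] is a Gram factor.
    Positivity thus becomes an equation, which serves the vanishing arguments and, later,
    measurability. *)
Lemma psdP n (G : 'M[C]_n) : psd G <-> exists A : 'M[C]_n, G = A^H *m A.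
Proof.
split=> [[hG pG]|[A ->]]; last exact: psd_gram.
have nG : G \is normalmx.
  by apply/normalmxP; rewrite -adjmx_trC hG.
have uS := spectral_unitarymx G.
have := orthomx_spectralP nG; set S := spectralmx G in uS *; set d := spectral_diag G => dec.
rewrite invmx_unitary // -adjmx_trC in dec.
have SS : S *m S^H = 1%:M by rewrite adjmx_trC; apply/unitarymxP.
have d_ge0 i : 0 <= d 0 i.
  have := pG (S^H *m delta_mx i 0); rewrite dec adjmxM adjmxK.
  rewrite !mulmxA -(mulmxA _ S) SS mulmx1 -(mulmxA _ S) SS mulmx1.
  by rewrite form_delta !mxE eqxx.
exists (diag_mx (map_mx (fun x : C => sqrtC x) d) *m S).
rewrite adjmxM !mulmxA -(mulmxA S^H) {1}dec; congr (_ *m _ *m _).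
apply/matrixP => i j; rewrite !mxE (bigD1 j) //= big1 ?addr0; last first.
  by move=> k ki; rewrite [X in _ * X]mxE (negbTE ki) mulr0.
rewrite adjmxE !mxE eqxx eq_sym mulr1n; case: eqP => [->|_]; last by rewrite conjC0 mul0r.
by rewrite mulr1n conj_Creal ?ger0_real ?sqrtC_ge0 // -expr2 sqrtCK.
Qed.

Lemma psd_mulmx0 n (G : 'M[C]_n) (v : 'cV[C]_n) :
  psd G -> (v^H *m G *m v) 0 0 = 0 -> G *m v = 0.
Proof.
move=> /psdP [A ->]; rewrite -!mulmxA mulmxA -adjmxM => /norm_eq0 ->.
by rewrite mulmx0.
Qed.

Lemma psdD n (A B : 'M[C]_n) : psd A -> psd B -> psd (A + B).
Proof.
move=> [hA pA] [hB pB]; split=> [|v]; first by rewrite adjmxD hA hB.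
by rewrite mulmxDr mulmxDl mxE addr_ge0.
Qed.

Lemma psd0 n : psd (0 : 'M[C]_n).
Proof. by split=> [|v]; rewrite ?adjmx0 // mulmx0 mul0mx mxE. Qed.

Lemma psd_sum n (I : finType) (F : I -> 'M[C]_n) :
  (forall i, psd (F i)) -> psd (\sum_i F i).
Proof. by move=> h; elim/big_ind: _ => //; [exact: psd0|exact: psdD]. Qed.

Lemma psd_congr n m (A : 'M[C]_n) (B : 'M[C]_(n, m)) : psd A -> psd (B^H *m A *m B).
Proof. by move=> /psdP [K ->]; rewrite mulmxA -adjmxM -mulmxA; apply: psd_gram. Qed.

Lemma psdZ n (A : 'M[C]_n) (a : C) : 0 <= a -> psd A -> psd (a *: A).
Proof.
move=> a0 [hA pA]; split=> [|v].
  by rewrite adjmxZ hA conj_Creal // ger0_real.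
by rewrite -scalemxAr -scalemxAl mxE mulr_ge0.
Qed.

Lemma psd1 n : psd (1%:M : 'M[C]_n).
Proof. by have := psd_gram (1%:M : 'M[C]_n); rewrite adjmx1 mulmx1. Qed.

Lemma mxtrace_psd_ge0 n (G : 'M[C]_n) : psd G -> 0 <= \tr G.
Proof.
move=> [_ pG]; apply: sumr_ge0 => i _.
by have := pG (delta_mx i 0); rewrite form_delta.
Qed.

End Adjoint.

(** * Optimality conditions *)

Section Forms.
Variables (F : comNzRingType) (n : nat).

Lemma mulmx11E (A : 'M[F]_(1, n)) (B : 'M[F]_(n, 1)) (D : 'M[F]_(1, n)) (E : 'M[F]_(n, 1)) :
  (A *m B *m D *m E) 0 0 = (A *m B) 0 0 * (D *m E) 0 0.
Proof. by rewrite -mulmxA [LHS]mxE big_ord1. Qed.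

Lemma mxformD (u : 'M[F]_(1, n)) A B (w : 'M[F]_(n, 1)) :
  (u *m (A + B) *m w) 0 0 = (u *m A *m w) 0 0 + (u *m B *m w) 0 0.
Proof. by rewrite mulmxDr mulmxDl mxE. Qed.

Lemma mxformB (u : 'M[F]_(1, n)) A B (w : 'M[F]_(n, 1)) :
  (u *m (A - B) *m w) 0 0 = (u *m A *m w) 0 0 - (u *m B *m w) 0 0.
Proof. by rewrite mulmxBr mulmxBl mxE [X in _ + X = _]mxE. Qed.

Lemma mxformZ (u : 'M[F]_(1, n)) (a : F) A (w : 'M[F]_(n, 1)) :
  (u *m (a *: A) *m w) 0 0 = a * (u *m A *m w) 0 0.
Proof. by rewrite -scalemxAr -scalemxAl mxE. Qed.

(** Matches the four terms of [T A T] for [T = 1 - e N], so that a success probability can be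
    expanded in powers of [e]. *)
Lemma mxform_expand (u : 'M[F]_(1, n)) A1 A2 A3 A4 (w : 'M[F]_(n, 1)) (q e f : F) :
  q * (u *m (A1 - e *: A2 - e *: A3 + f *: A4) *m w) 0 0 =
  q * (u *m A1 *m w) 0 0 - e * (q * (u *m A2 *m w) 0 0)
  - e * (q * (u *m A3 *m w) 0 0) + f * (q * (u *m A4 *m w) 0 0).
Proof.
rewrite mxformD mxformB mxformB !mxformZ.
by rewrite mulrDr !mulrBr ![q * (e * _)]mulrCA [q * (f * _)]mulrCA.
Qed.

End Forms.

Section Optimality.
Variable R : realType.
Local Notation C := (R[i]).

Lemma conjCM (x y : C) : (x * y)^* = x^* * y^*.
Proof. exact: rmorphM. Qed.

Lemma conjCD (x y : C) : (x + y)^* = x^* + y^*.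
Proof. exact: rmorphD. Qed.

Lemma conjC_sum (I : finType) (F : I -> C) : (\sum_i F i)^* = \sum_i (F i)^*.
Proof. exact: rmorph_sum. Qed.

Lemma mxtrace_gram_eq0 m n (X : 'M[C]_(m, n)) : \tr (X^H *m X) = 0 -> X = 0.
Proof.
rewrite /mxtrace => /eqP; rewrite psumr_eq0; last first.
  move=> i _; rewrite mxE sumr_ge0 // => k _.
  by rewrite adjmxE mulrC mul_conjC_ge0.
move=> /allP h; apply/matrixP => k j; rewrite mxE.
have := h j (mem_index_enum j); rewrite /= mxE psumr_eq0; last first.
  by move=> i _; rewrite adjmxE mulrC mul_conjC_ge0.
move=> /allP /(_ k (mem_index_enum k)) /=.
by rewrite adjmxE mulrC mul_conjC_eq0 => /eqP.
Qed.

(** For Gram factors [K] and [L] the trace is the squared Frobenius norm of [K L^H]. This is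
    complementary slackness in matrix form. *)
Lemma mxtrace_mul_psd n (A B : 'M[C]_n) : psd A -> psd B ->
  0 <= \tr (A *m B) /\ (\tr (A *m B) = 0 -> A *m B = 0).
Proof.
move=> /psdP [K ->] /psdP [L ->].
have -> : \tr (K^H *m K *m (L^H *m L)) = \tr ((K *m L^H)^H *m (K *m L^H)).
  by rewrite adjmxM adjmxK !mulmxA mxtrace_mulC !mulmxA.
split; first exact/mxtrace_psd_ge0/psd_gram.
by move=> /mxtrace_gram_eq0 e; rewrite !mulmxA -(mulmxA K^H) e mulmx0 mul0mx.
Qed.

Lemma mxtrace_rank1 n (A : 'M[C]_n) (v : 'cV[C]_n) :
  \tr (A *m v *m v^H) = (v^H *m A *m v) 0 0.
Proof. by rewrite mxtrace_mulC mulmxA trace_mx11. Qed.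

Lemma mxtrace_rank1l n (A : 'M[C]_n) (v : 'cV[C]_n) :
  \tr (v *m v^H *m A) = (v^H *m A *m v) 0 0.
Proof. by rewrite -mulmxA mxtrace_mulC trace_mx11. Qed.

Lemma le0_of_le_small (x y e0 : C) : x \is Num.real -> 0 < e0 ->
  (forall e, 0 < e -> e <= e0 -> x <= e * y) -> x <= 0.
Proof.
move=> xr e0p h; rewrite real_leNgt ?real0 //; apply/negP => x0.
have y0 : 0 < e0 * y by apply: lt_le_trans (h _ e0p (lexx _)).
have d0 : 0 < x + e0 * y by rewrite addr_gt0.
(* If [x > 0], this value of [e] yields [x <= x * t] with [t = e0 y / (x + e0 y) < 1]. *)
have hx : x <= e0 * (x / (x + e0 * y)) * y.
  apply: h; first by rewrite mulr_gt0 ?divr_gt0.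
  by rewrite ler_piMr ?(ltW e0p) // ler_pdivrMr // mul1r lerDl ltW.
move: hx; have -> : e0 * (x / (x + e0 * y)) * y = x * ((e0 * y) / (x + e0 * y)) by ring.
have : x * (e0 * y / (x + e0 * y)) < x.
  by rewrite gtr_pMr // ltr_pdivrMr // mul1r ltrDr.
by move=> lt1 le1; move: (le_lt_trans le1 lt1); rewrite ltxx.
Qed.

Variables (n k : nat) (p : 'I_k -> R) (psi : 'I_k -> 'cV[C]_n).
Hypothesis p_ge0 : forall i, 0 <= p i.
Local Notation pc i := (real_complex R (p i)).

(** The Lagrange operator of the minimum-error problem, written in terms of the vectors
    [phi i = Pi i *m psi i] so that it makes sense without a measurement. *)
Definition lambda (phi : 'I_k -> 'cV[C]_n) : 'M[C]_n :=
  \sum_(i < k) pc i *: (phi i *m (psi i)^H).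

Variable Pi : 'I_k -> 'M[C]_n.
Hypothesis Pi_opt : attains_optimum p psi Pi.
Let L := lambda (fun i => Pi i *m psi i).

Let Pi_psd i : psd (Pi i). Proof. by case: Pi_opt => -[]. Qed.
Let Pi_sum : \sum_i Pi i = 1%:M. Proof. by case: Pi_opt => -[]. Qed.

Lemma pc_ge0 i : 0 <= pc i.
Proof. by rewrite lecR. Qed.

(* First-order variation towards
   [Pi'_i = (1 - e v v^H) Pi_i (1 - e v v^H) + (i == j) (2 e - e^2 |v|^2) v v^H]. *)
Lemma optimum_variation j (v : 'cV[C]_n) :
  pc j * (v^H *m (psi j *m (psi j)^H) *m v) 0 0 *+ 2 <=
  (v^H *m (L + L^H) *m v) 0 0.
Proof.
have [N NE] : {N | N = v *m v^H} by exists (v *m v^H).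
pose nv := (v^H *m v) 0 0.
have nv0 : 0 <= nv by exact: norm_ge0.
have NH : N^H = N by rewrite NE adjmxM adjmxK.
have NN : N *m N = nv *: N.
  by rewrite NE mulmxA -(mulmxA v) [v^H *m v]mx11_scalar mul_mx_scalar scalemxAl.
have psdN : psd N by rewrite NE; have := psd_gram (v^H); rewrite adjmxK.
pose b := \sum_i pc i * ((psi i)^H *m (N *m Pi i *m N) *m psi i) 0 0.
pose a := (v^H *m L *m v) 0 0.
pose c := (v^H *m (psi j *m (psi j)^H) *m v) 0 0.
have cE : ((psi j)^H *m N *m psi j) 0 0 = c.
  by rewrite /c NE !mulmxA !mulmx11E mulrC.
have aE : \sum_i pc i * ((psi i)^H *m (N *m Pi i) *m psi i) 0 0 = a.
  rewrite /a /L /lambda mulmx_sumr mulmx_suml summxE; apply: eq_bigr => i _.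
  rewrite -scalemxAr -scalemxAl [RHS]mxE NE; congr (_ * _).
  by rewrite !mulmxA [RHS]mulmx11E -(mulmxA _ (Pi i)) mulmx11E mulrC !mulmxA.
have aHE : \sum_i pc i * ((psi i)^H *m (Pi i *m N) *m psi i) 0 0 = a^*.
  rewrite -aE conjC_sum; apply: eq_bigr => i _; rewrite conjCM conj_real.
  congr (_ * _); rewrite -adjmxE !adjmxM adjmxK NH (proj1 (Pi_psd i)).
  by rewrite !mulmxA.
have aaE : (v^H *m (L + L^H) *m v) 0 0 = a + a^*.
  rewrite mulmxDr mulmxDl mxE; congr (_ + _).
  by rewrite /a -adjmxE !adjmxM adjmxK mulmxA.
have cr : 0 <= c by have := gram_ge0 v (psi j)^H; rewrite adjmxK.
have br : 0 <= b.
  apply: sumr_ge0 => i _; rewrite mulr_ge0 ?pc_ge0 //.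
  have [_ ->] // : psd (N *m Pi i *m N) by rewrite -{1}NH; exact: psd_congr.
have rr : a + a^* \is Num.real by rewrite CrealE conjCD conjCK addrC.
have nv1 : 0 < nv + 1 by rewrite ltr_wpDl.
rewrite aaE -/c -subr_le0.
(* Comparison with [Pi'] gives [x <= e * y], where [x] is the first-order gain and [y] comes from
   the terms in [e^2]. The bound [e <= 1 / (|v|^2 + 1)] ensures [e |v|^2 <= 1], hence [d >= 0]
   below. *)
apply: (@le0_of_le_small _ (pc j * nv * c - b) (nv + 1)^-1).
- by rewrite realB // rpredMn // realM // ger0_real // pc_ge0.
- by rewrite invr_gt0.
move=> e e0 e1.
have er : e^* = e by rewrite conj_Creal // gtr0_real.
have en : e * nv <= 1.
  apply: (@le_trans _ _ ((nv + 1)^-1 * (nv + 1))).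
    by apply: ler_pM => //; rewrite ?ltW // ltrDl.
  by rewrite mulVf // gt_eqF.
pose T := 1%:M - e *: N.
have TH : T^H = T by rewrite adjmxB adjmx1 adjmxZ er NH.
(* [T *m T = 1 - d N], so adding [d N] to outcome [j] restores the sum 1. *)
pose d := e *+ 2 - e ^+ 2 * nv.
have d0 : 0 <= d.
  rewrite /d expr2 -mulrA -mulr_natr -mulrBr mulr_ge0 ?(ltW e0) // subr_ge0.
  by rewrite (le_trans en) // ler1n.
have TAT A : T *m A *m T = A - e *: (N *m A) - e *: (A *m N) + e ^+ 2 *: (N *m A *m N).
  rewrite /T mulmxBl mul1mx mulmxBr mulmx1 mulmxBl -scalemxAl -!scalemxAr -scalemxAl.
  by rewrite scalerA -expr2 opprB !addrA addrAC -!addrA; congr (_ + _); rewrite addrCA.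
pose Pi' i := T *m Pi i *m T + (if i == j then d else 0) *: N.
have povm' : povm Pi'.
  split=> [i|].
    apply: psdD; first by rewrite -{1}TH; exact: psd_congr.
    by apply: psdZ => //; case: ifP.
  rewrite /Pi' big_split /= -mulmx_suml -mulmx_sumr Pi_sum -scaler_suml.
  rewrite -big_mkcond /= big_pred1_eq TAT !mulmx1 mul1mx NN /d.
  by apply/matrixP => x y; rewrite !mxE; ring.
have := proj2 Pi_opt Pi' povm'.
have -> : success p psi Pi' =
    success p psi Pi - e * a - e * a^* + e ^+ 2 * b + pc j * (d * c).
  rewrite -aHE -aE /b /success !mulr_sumr -!sumrB -big_split /=.
  have -> : pc j * (d * c) = \sum_(i < k) if i == j then pc i * (d * c) else 0.
    by rewrite -big_mkcond big_pred1_eq.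
  rewrite -big_split /=; apply: eq_bigr => i _.
  rewrite /Pi' mxformD mulrDr; congr (_ + _).
    by rewrite TAT mxform_expand.
  case: eqP => [->|_]; last by rewrite mxformZ mul0r mulr0.
  by rewrite mxformZ cE.
rewrite -subr_ge0 => h.
have : 0 <= e * (e * (pc j * nv * c - b) - (pc j * c *+ 2 - (a + a^*))).
  by move: h; congr (is_true (0 <= _)); rewrite /d; ring.
by rewrite pmulr_rge0 // subr_ge0.
Qed.


Let s := success p psi Pi.

Lemma mxtrace_lambda : \tr L = s.
Proof.
rewrite /L /lambda raddf_sum; apply: eq_bigr => i _ /=.
by rewrite mxtraceZ mxtrace_rank1.
Qed.

Lemma success_real : s^* = s.
Proof.
rewrite /s /success conjC_sum; apply: eq_bigr => i _.
by rewrite conjCM conj_real conj_Creal // ger0_real // (proj2 (Pi_psd i)).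
Qed.

(** The necessary Holevo conditions. The variation only shows that the Hermitian part [H] of [L]
    dominates each [p_j rho_j]. The traces of the products [(H - p_j rho_j) Pi_j] are nonnegative
    with sum 0, so each product is 0; adding them up gives [H = L^H], whence [L] is Hermitian. *)
Theorem optimum_lambda :
  [/\ L^H = L, forall j, psd (L - pc j *: (psi j *m (psi j)^H))
     & forall j, (L - pc j *: (psi j *m (psi j)^H)) *m Pi j = 0].
Proof.
have two : (2%:R : C) != 0 by rewrite pnatr_eq0.
have two0 : 0 <= (2%:R : C)^-1 by rewrite invr_ge0 ler0n.
have [H HE] : {H | H = 2%:R^-1 *: (L + L^H)} by exists (2%:R^-1 *: (L + L^H)).
have HH : H^H = H.
  by rewrite HE adjmxZ adjmxD adjmxK addrC conj_Creal // ger0_real.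
pose rho j := psi j *m (psi j)^H.
have rhoH j : (rho j)^H = rho j by rewrite /rho adjmxM adjmxK.
have psdG j : psd (H - pc j *: rho j).
  split=> [|v]; first by rewrite adjmxB adjmxZ conj_real HH rhoH.
  rewrite mxformB mxformZ subr_ge0 HE mxformZ ler_pdivlMl ?ltr0n //.
  by rewrite mulrC mulr_natr optimum_variation.
have trG : \sum_j \tr ((H - pc j *: rho j) *m Pi j) = 0.
  under eq_bigr do rewrite mulmxBl raddfB /= -scalemxAl mxtraceZ mxtrace_rank1l.
  have -> : forall f, \sum_i (\tr (H *m Pi i) - f i) = \tr H - \sum_i f i.
    move=> f; rewrite sumrB; congr (_ - _).
    by rewrite -[in RHS](mulmx1 H) -Pi_sum mulmx_sumr raddf_sum.
  rewrite HE mxtraceZ mxtraceD mxtrace_lambda.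
  have -> : \tr L^H = s.
    rewrite -success_real -mxtrace_lambda /mxtrace conjC_sum.
    by apply: eq_bigr => i _; rewrite adjmxE.
  have -> : 2%:R^-1 * (s + s) = s by rewrite -mulr2n -[s *+ 2]mulr_natl mulrA mulVf // mul1r.
  exact: subrr.
have G0 j : (H - pc j *: rho j) *m Pi j = 0.
  apply: (proj2 (mxtrace_mul_psd (psdG j) (Pi_psd j))).
  move/eqP: trG; rewrite psumr_eq0; last first.
    by move=> i _; apply: (proj1 (mxtrace_mul_psd (psdG i) (Pi_psd i))).
  by move=> /allP /(_ j (mem_index_enum j)) /eqP.
have HL : H = L^H.
  have : \sum_j (H - pc j *: rho j) *m Pi j = 0 by rewrite big1.
  under eq_bigr do rewrite mulmxBl.
  rewrite sumrB -mulmx_sumr Pi_sum mulmx1 => /eqP; rewrite subr_eq0 => /eqP ->.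
  rewrite /L /lambda adjmx_sum; apply: eq_bigr => i _.
  by rewrite adjmxZ conj_real !adjmxM adjmxK (proj1 (Pi_psd i)) -scalemxAl mulmxA.
have LL : L^H = L by rewrite -HL -[RHS]adjmxK -HL HH.
by split=> // j; rewrite -LL -HL.
Qed.

End Optimality.

(** * Stationary families: derivation from optimality, uniqueness, unitary covariance *)

Section Stationary.
Variable R : realType.
Local Notation C := (R[i]).
Variables (n k : nat) (p : 'I_k -> R).
Hypothesis p_gt0 : forall i, 0 < p i.
Local Notation pc i := (real_complex R (p i)).
Implicit Types (psi phi : 'I_k -> 'cV[C]_n).

Lemma mulmx_cV1 (v : 'cV[C]_n) (A : 'M[C]_1) : v *m A = A 0 0 *: v.
Proof. by rewrite {1}[A]mx11_scalar mul_mx_scalar. Qed.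

Lemma pc_neq0 i : pc i != 0.
Proof. by rewrite gt_eqF // ltcR. Qed.

(** Linear independence given by a biorthogonal family [x], whose members serve directly as test
    vectors and read off coefficients. *)
Definition independent psi := exists x : 'I_k -> 'cV[C]_n,
  forall i j, ((psi j)^H *m x i) 0 0 = (i == j)%:R.

(* The conditions characterising [phi i = Pi i *m psi i] for an optimal measurement. *)
Definition stationary psi phi :=
  [/\ forall i j, i != j -> ((phi i)^H *m phi j) 0 0 = 0,
      forall i, ((phi i)^H *m phi i) 0 0 = ((psi i)^H *m phi i) 0 0,
      (lambda p psi phi)^H = lambda p psi phi &
      forall j, psd (lambda p psi phi - pc j *: (psi j *m (psi j)^H))].

Lemma lambda_dual psi phi (x : 'I_k -> 'cV[C]_n) i :
  (forall i j, ((psi j)^H *m x i) 0 0 = (i == j)%:R) ->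
  lambda p psi phi *m x i = pc i *: phi i.
Proof.
move=> xd; rewrite /lambda mulmx_suml (bigD1 i) //= big1 ?addr0 => [|j ji].
  by rewrite -scalemxAl -mulmxA mulmx_cV1 xd eqxx scale1r.
by rewrite -scalemxAl -mulmxA mulmx_cV1 xd eq_sym (negbTE ji) scale0r scaler0.
Qed.

Lemma adj_lambda_mul psi phi (v : 'cV[C]_n) :
  (lambda p psi phi)^H *m v = \sum_i (pc i * ((phi i)^H *m v) 0 0) *: psi i.
Proof.
rewrite /lambda adjmx_sum mulmx_suml; apply: eq_bigr => i _.
by rewrite adjmxZ conj_real adjmxM adjmxK -scalemxAl -mulmxA mulmx_cV1 scalerA.
Qed.

Lemma adj_form (u v : 'cV[C]_n) : (u^H *m v) 0 0 = ((v^H *m u) 0 0)^*.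
Proof. by rewrite -adjmxE adjmxM adjmxK. Qed.

Lemma form_sum (u : 'M[C]_(1, n)) (c : 'I_k -> C) (f : 'I_k -> 'cV[C]_n) :
  (u *m \sum_i c i *: f i) 0 0 = \sum_i c i * (u *m f i) 0 0.
Proof.
by rewrite mulmx_sumr summxE; apply: eq_bigr => i _; rewrite -scalemxAr mxE.
Qed.

Lemma form_dual psi (x : 'I_k -> 'cV[C]_n) (c : 'I_k -> C) i :
  (forall i j, ((psi j)^H *m x i) 0 0 = (i == j)%:R) ->
  ((x i)^H *m \sum_j c j *: psi j) 0 0 = c i.
Proof.
move=> xd; rewrite form_sum (bigD1 i) //= big1 ?addr0 => [|j ji].
  by rewrite (adj_form (x i)) xd eqxx conjC1 mulr1.
by rewrite (adj_form (x i)) xd eq_sym (negbTE ji) conjC0 mulr0.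
Qed.

(** Since [L Pi_o = p_o rho_o Pi_o], the operator [L] sends the range of [Pi_o] into the line of
    [psi o]. Independence of the states then decouples the outcomes. *)
Theorem optimum_stationary psi Pi : independent psi -> attains_optimum p psi Pi ->
  stationary psi (fun i => Pi i *m psi i) /\
  forall i o, o != i -> Pi o *m (Pi i *m psi i) = 0.
Proof.
move=> [x xd] opt; have p_ge0 i : 0 <= p i by exact: ltW.
have [LH Lpsd LPi] := optimum_lambda p_ge0 opt.
set phi := fun i => Pi i *m psi i in LH Lpsd LPi *.
set L := lambda p psi phi in LH Lpsd LPi *.
have [[Pi_psd Pi_sum] _] := opt.
have PiH i : (Pi i)^H = Pi i by case: (Pi_psd i).
have LPiE o v : L *m (Pi o *m v) = (pc o * ((phi o)^H *m v) 0 0) *: psi o.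
  move/eqP: (LPi o); rewrite mulmxBl subr_eq0 mulmxA => /eqP ->.
  rewrite -!scalemxAl -!mulmxA mulmx_cV1 scalerA.
  by rewrite /phi adjmxM PiH mulmxA.
(* [L phi_i] is a multiple of [psi i], and it is also the sum over [o] of the vectors
   [L Pi_o phi_i]. Pairing with [x o] compares the coefficients of [psi o]. *)
have key i o : pc o * ((phi o)^H *m phi i) 0 0 =
               (o == i)%:R * (pc i * ((phi i)^H *m psi i) 0 0).
  have e : L *m phi i = \sum_o (pc o * ((phi o)^H *m phi i) 0 0) *: psi o.
    transitivity (L *m \sum_o Pi o *m phi i); first by rewrite -mulmx_suml Pi_sum mul1mx.
    by rewrite mulmx_sumr; apply: eq_bigr => j _; rewrite LPiE.
  rewrite -(form_dual (fun o => pc o * ((phi o)^H *m phi i) 0 0) o xd) -e LPiE -scalemxAr mxE.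
  by rewrite (adj_form (x o)) xd mulrC; case: eqP => _; rewrite ?conjC1 ?conjC0.
split; first split=> //.
- move=> o i oi; apply: (mulfI (pc_neq0 o)).
  by rewrite key (negbTE oi) mul0r mulr0.
- move=> i; apply: (mulfI (pc_neq0 i)); rewrite key eqxx mul1r /phi.
  by rewrite adjmxM PiH mulmxA.
move=> i o oi; rewrite -/(phi i).
apply: psd_mulmx0 => //; apply: (mulfI (pc_neq0 i)).
rewrite mulr0; transitivity ((pc i *: ((phi i)^H *m Pi o *m phi i)) 0 0); first by rewrite [RHS]mxE.
(* As [p_i phi_i = L x_i], the form is a multiple of the pairing of [x i] with [psi o], which is 0
   for [o != i]. *)
have -> : pc i *: ((phi i)^H *m Pi o *m phi i) = (x i)^H *m (L *m (Pi o *m phi i)).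
  rewrite [RHS]mulmxA -{1}LH -adjmxM /L (lambda_dual _ _ xd) adjmxZ conj_real.
  by rewrite -scalemxAl mulmxA.
rewrite LPiE -scalemxAr mxE (adj_form (x i)) xd eq_sym (negbTE oi) conjC0 mulr0 //.
Qed.

Section Uniqueness.
Variables (psi : 'I_k -> 'cV[C]_n) (x : 'I_k -> 'cV[C]_n).
Hypothesis xd : forall i j, ((psi j)^H *m x i) 0 0 = (i == j)%:R.

Let form_rank1 (v : 'cV[C]_n) j :
  (v^H *m (psi j *m (psi j)^H) *m v) 0 0 = `|((psi j)^H *m v) 0 0| ^+ 2.
Proof.
by rewrite !mulmxA mulmx11E [(v^H *m _) 0 0]adj_form mulrC -normCK.
Qed.

Lemma psd_form_le (L : 'M[C]_n) (v : 'cV[C]_n) j : psd (L - pc j *: (psi j *m (psi j)^H)) ->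
  pc j * `|((psi j)^H *m v) 0 0| ^+ 2 <= (v^H *m L *m v) 0 0.
Proof. by move=> [_ /(_ v)]; rewrite mxformB mxformZ form_rank1 subr_ge0. Qed.

(** Testing [L >= p_i rho_i] at the dual vector [x i], where [L x_i = p_i phi_i], would give
    [p_i <= 0] if [phi i] were 0. *)
Lemma stationary_neq0 phi i : stationary psi phi -> 0 < ((phi i)^H *m phi i) 0 0.
Proof.
move=> [_ _ _ /(_ i) /psd_form_le le]; rewrite lt_def norm_ge0 andbT.
apply/eqP => /norm_eq0 phi0; have := le (x i).
rewrite -mulmxA (lambda_dual _ _ xd) phi0 scaler0 mulmx0 xd eqxx normr1 expr1n mulr1 mxE.
by rewrite lecR leNgt p_gt0.
Qed.

Let sq (phi : 'I_k -> 'cV[C]_n) i := ((phi i)^H *m phi i) 0 0.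
(** For a stationary family, the orthogonal projection onto the span of the [phi i]. *)
Let P (phi : 'I_k -> 'cV[C]_n) := \sum_i (sq phi i)^-1 *: (phi i *m (phi i)^H).

Lemma lambda_phi phi i : stationary psi phi ->
  lambda p psi phi *m phi i = (pc i * sq phi i) *: psi i.
Proof.
move=> [orth _ LH _]; rewrite -LH adj_lambda_mul (bigD1 i) //= big1 ?addr0 // => j ji.
by rewrite orth // mulr0 scale0r.
Qed.

Lemma proj_phi phi i : stationary psi phi -> P phi *m phi i = phi i.
Proof.
move=> st; have [orth _ _ _] := st.
rewrite /P mulmx_suml (bigD1 i) //= big1 ?addr0 => [|j ji].
  rewrite -scalemxAl -mulmxA mulmx_cV1 scalerA mulVf ?scale1r //.
  by rewrite gt_eqF // stationary_neq0.
by rewrite -scalemxAl -mulmxA mulmx_cV1 orth // scale0r scaler0.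
Qed.

Lemma phi_span phi i : stationary psi phi ->
  phi i = (pc i)^-1 *: \sum_j (pc j * ((phi j)^H *m x i) 0 0) *: psi j.
Proof.
move=> [_ _ LH _]; rewrite -adj_lambda_mul LH (lambda_dual _ _ xd).
by rewrite scalerA mulVf ?scale1r // pc_neq0.
Qed.

(** Each [psi j] is a multiple of [lambda p psi phi' *m phi' j], so it lies in the span of [phi']
    and is fixed by the projection. By [phi_span] the vectors [phi i] are combinations of the
    [psi j], hence fixed as well. *)
Lemma proj_lambda phi phi' : stationary psi phi -> stationary psi phi' ->
  P phi' *m lambda p psi phi = lambda p psi phi.
Proof.
move=> st st'; have fix_psi j : P phi' *m psi j = psi j.
  have c0 : pc j * sq phi' j != 0.
    by rewrite mulf_neq0 ?pc_neq0 // gt_eqF // stationary_neq0.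
  apply: (scalerI c0); rewrite scalemxAr -lambda_phi // mulmxA; congr (_ *m _).
  rewrite /lambda mulmx_sumr; apply: eq_bigr => i _.
  by rewrite -scalemxAr mulmxA proj_phi.
rewrite {1}/lambda mulmx_sumr; apply: eq_bigr => i _.
rewrite -scalemxAr mulmxA; congr (_ *: (_ *m _)).
rewrite (phi_span i st) -scalemxAr mulmx_sumr; congr (_ *: _).
by apply: eq_bigr => j _; rewrite -scalemxAr fix_psi.
Qed.

(** A duality gap: the trace of [lambda p psi phi] is the value of [phi], and inserting the
    projection onto the span of [phi'] splits it into the value of [phi'] plus slack terms, all
    nonnegative. *)
Lemma stationary_gap phi phi' : stationary psi phi -> stationary psi phi' ->
  \sum_i pc i * sq phi i - \sum_i pc i * sq phi' i =
  \sum_i (sq phi' i)^-1 *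
    ((phi' i)^H *m (lambda p psi phi - pc i *: (psi i *m (psi i)^H)) *m phi' i) 0 0.
Proof.
move=> st st'; have [_ sqE _ _] := st; have [_ sqE' _ _] := st'.
have -> : \sum_i pc i * sq phi i = \tr (lambda p psi phi).
  rewrite /lambda raddf_sum; apply: eq_bigr => i _ /=.
  by rewrite mxtraceZ mxtrace_mulC trace_mx11 /sq sqE.
have -> : \tr (lambda p psi phi) = \tr (P phi' *m lambda p psi phi) by rewrite proj_lambda.
rewrite /P mulmx_suml raddf_sum -sumrB; apply: eq_bigr => i _ /=.
rewrite -scalemxAl mxtraceZ mxtrace_rank1l mxformB mxformZ form_rank1 mulrBr; congr (_ - _).
have s0 := stationary_neq0 i st'.
rewrite -sqE' ger0_norm ?(ltW s0) // mulrCA; congr (_ * _).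
by rewrite expr2 mulrA mulVf ?mul1r // gt_eqF.
Qed.

(** Exchanging the roles of the two families shows that their values agree, so every slack term
    vanishes. Hence [L], the operator of [phi], maps [phi' i] to a multiple of [psi i], exactly as
    it does [phi i]. *)
Theorem stationary_unique phi phi' : stationary psi phi -> stationary psi phi' ->
  forall i, exists2 c : C, c != 0 & phi' i = c *: phi i.
Proof.
move=> st st'.
have gap_ge0 f f' : stationary psi f -> stationary psi f' ->
    forall i, 0 <= (sq f' i)^-1 *
    ((f' i)^H *m (lambda p psi f - pc i *: (psi i *m (psi i)^H)) *m f' i) 0 0.
  move=> sf sf' i; have [_ _ _ psdf] := sf.
  by rewrite mulr_ge0 // ?invr_ge0 ?norm_ge0 // (proj2 (psdf i)).
have le f f' : stationary psi f -> stationary psi f' ->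
    \sum_i pc i * sq f' i <= \sum_i pc i * sq f i.
  move=> sf sf'; rewrite -subr_ge0 stationary_gap //.
  by apply: sumr_ge0 => i _; exact: gap_ge0.
have eq0 : \sum_i pc i * sq phi i - \sum_i pc i * sq phi' i = 0.
  by apply/eqP; rewrite subr_eq0 eq_le !le.
have Lphi' i : lambda p psi phi *m phi' i = (pc i * sq phi' i) *: psi i.
  have s0 := stationary_neq0 i st'; have [_ sqE _ _] := st'.
  have [_ _ _ psdL] := st.
  move/eqP: eq0; rewrite stationary_gap // psumr_eq0 => [|j _]; last exact: gap_ge0.
  move=> /allP /(_ i (mem_index_enum i)) /=; rewrite mulf_eq0 invr_eq0 gt_eqF //=.
  move=> /eqP /(psd_mulmx0 (psdL i)) /eqP.
  rewrite mulmxBl subr_eq0 => /eqP ->.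
  by rewrite -scalemxAl -mulmxA mulmx_cV1 -sqE scalerA.
move=> i; have s0 := stationary_neq0 i st; have s0' := stationary_neq0 i st'.
(* The scaling makes [L] send both terms to [p_i psi_i], so [L d = 0]; then [L >= p_j rho_j] makes
   [d] orthogonal to every [psi j]. *)
pose d := (sq phi' i)^-1 *: phi' i - (sq phi i)^-1 *: phi i.
have Ld : lambda p psi phi *m d = 0.
  rewrite /d mulmxBr -!scalemxAr Lphi' lambda_phi // !scalerA mulrCA mulVf ?gt_eqF //.
  by rewrite mulrCA mulVf ?gt_eqF // subrr.
have psid j : ((psi j)^H *m d) 0 0 = 0.
  have [_ _ _ /(_ j) /(@psd_form_le _ d)] := st.
  rewrite -mulmxA Ld mulmx0 [X in _ <= X]mxE pmulr_rle0 ?ltcR // => le0.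
  apply/eqP; rewrite -normr_eq0 -sqrf_eq0 eq_le le0 exprn_ge0 //.
have phid f : stationary psi f -> (d^H *m f i) 0 0 = 0.
  move=> sf; rewrite (phi_span i sf) -scalemxAr mxE form_sum big1 ?mulr0 // => j _.
  by rewrite (adj_form d) psid conjC0 mulr0.
(* [d] is a combination of [phi i] and [phi' i], both in the span of the states, to which [d] is
   orthogonal. *)
have d0 : d = 0.
  apply: norm_eq0; rewrite {2}/d mulmxBr -!scalemxAr.
  by rewrite mxE [X in _ + X]mxE mxE [X in - X]mxE !phid // !mulr0 subr0.
exists (sq phi' i / sq phi i).
  by rewrite mulf_neq0 ?invr_eq0 ?gt_eqF.
move/eqP: d0; rewrite subr_eq0 => /eqP /(congr1 (fun v => sq phi' i *: v)).
by rewrite !scalerA mulfV ?scale1r // gt_eqF.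
Qed.

End Uniqueness.

Lemma stationary_unitary psi phi (T : 'M[C]_n) : T^H *m T = 1%:M ->
  stationary psi phi -> stationary (fun i => T *m psi i) (fun i => T *m phi i).
Proof.
move=> TT [orth sqE LH psdL].
have form u v : (T *m u)^H *m (T *m v) = u^H *m v :> 'M[C]_1.
  by rewrite adjmxM mulmxA -(mulmxA _ T^H) TT mulmx1.
have LE : lambda p (fun i => T *m psi i) (fun i => T *m phi i) =
          T *m lambda p psi phi *m T^H.
  rewrite /lambda mulmx_sumr mulmx_suml; apply: eq_bigr => i _.
  by rewrite -scalemxAr -scalemxAl adjmxM !mulmxA.
split=> [i j|i||j]; rewrite ?form //; first exact: orth.
  by rewrite LE !adjmxM adjmxK LH mulmxA.
rewrite LE; have := psd_congr T^H (psdL j); rewrite adjmxK; congr psd.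
by rewrite mulmxBr mulmxBl -scalemxAr -scalemxAl adjmxM !mulmxA.
Qed.

End Stationary.

(** * LOCC discrimination forces a product vector *)

Section LoccProduct.
Variable R : realType.
Local Notation C := (R[i]).

(** Coefficient matrix of a two-qubit vector: local operators act on its two sides, and the vector
    is a product exactly when the determinant vanishes. *)
Definition unvec (e : 'cV[C]_(2 * 2)) : 'M[C]_2 :=
  \matrix_(i, j) e (mxtens_index (i, j)) 0.

Lemma sum_mxtens (V : nmodType) m n (F : 'I_(m * n) -> V) :
  \sum_k F k = \sum_i \sum_j F (mxtens_index (i, j)).
Proof.
rewrite pair_bigA /= (reindex (@mxtens_index m n)) /=.
  by apply: eq_bigr => -[].
exists (@mxtens_unindex m n) => x _; [exact: mxtens_indexK|exact: mxtens_unindexK].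
Qed.

Lemma unvec_tens (K L : 'M[C]_2) e : unvec (tensmx K L *m e) = K *m unvec e *m L^T.
Proof.
apply/matrixP => i j; rewrite mxE mxE sum_mxtens exchange_big /= mxE.
apply: eq_bigr => l _; rewrite mxE mulr_suml; apply: eq_bigr => k _.
by rewrite tensmxE !mxE mulrAC.
Qed.

Lemma form_unvec (e f : 'cV[C]_(2 * 2)) : (e^H *m f) 0 0 = \tr ((unvec e)^H *m unvec f).
Proof.
rewrite mxE sum_mxtens exchange_big; apply: eq_bigr => j _ /=; rewrite mxE.
by apply: eq_bigr => i _; rewrite !adjmxE !mxE.
Qed.

Lemma orthogonal_rows3 (r : 'I_3 -> 'rV[C]_2) :
  (forall a b, a != b -> r b *m (r a)^H = 0) -> exists a, r a = 0.
Proof.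
move=> orth; apply: contrapT => h.
have rn0 a : r a != 0 by apply/eqP => ra; apply: h; exists a.
pose X : 'M[C]_(3, 2) := \matrix_(a, j) r a 0 j.
have XX a b : (X *m X^H) b a = (r b *m (r a)^H) 0 0.
  by rewrite mxE [RHS]mxE; apply: eq_bigr => j _; rewrite !adjmxE !mxE.
have D : X *m X^H = diag_mx (\row_a (r a *m (r a)^H) 0 0).
  apply/matrixP => b a; rewrite XX [RHS]mxE; case: eqP => [->|/eqP ba].
    by rewrite mulr1n [RHS]mxE.
  by rewrite mulr0n orth 1?eq_sym // mxE.
have : (\rank (X *m X^H) <= 2)%N.
  by rewrite (leq_trans (mxrankM_maxl _ _)) // rank_leq_col.
rewrite leqNgt D mxrank_unit // unitmxE det_diag unitfE prodf_seq_neq0.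
apply/allP => a _ /=; rewrite mxE; apply/eqP => h0.
case/eqP: (rn0 a); apply: (can_inj (@adjmxK R _ _)); rewrite adjmx0.
by apply: norm_eq0; rewrite adjmxK.
Qed.

Lemma mxtrace_diag_mul (d : 'rV[C]_2) (A : 'M[C]_2) :
  \tr (diag_mx d *m A) = d 0 0 * A 0 0 + d 0 1 * A 1 1.
Proof.
rewrite mul_diag_mx /mxtrace big_ord_recl big_ord1 !mxE.
by have -> : lift ord0 ord0 = 1 :> 'I_2 by exact/val_inj.
Qed.

(** Write [E = S^H D S] with distinct eigenvalues. The two trace conditions are independent linear
    equations in the diagonal entries of [S M_b (S M_a)^H], so these vanish. The first rows of the
    [S M_a] are thus three pairwise orthogonal vectors in dimension 2; one is 0, and then row 0 of
    [S] is a left null vector of that [M_a]. *)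
Lemma orthogonal_det0 (M : 'I_3 -> 'M[C]_2) (E : 'M[C]_2) :
  E^H = E -> (forall c, E != c%:M) ->
  (forall a b, a != b -> \tr ((M a)^H *m M b) = 0) ->
  (forall a b, a != b -> \tr ((M a)^H *m E *m M b) = 0) ->
  exists a, \det (M a) = 0.
Proof.
move=> EH Ens orth orthE.
have nE : E \is normalmx by apply/normalmxP; rewrite -adjmx_trC EH.
have uS := spectral_unitarymx E.
have := orthomx_spectralP nE; set S := spectralmx E in uS *; set d := spectral_diag E => dec.
rewrite invmx_unitary // -adjmx_trC in dec.
have SS : S *m S^H = 1%:M by rewrite adjmx_trC; apply/unitarymxP.
have SS' : S^H *m S = 1%:M by exact: mulmx1C.
have d01 : d 0 0 != d 0 1.
  apply/eqP => dd; case/eqP: (Ens (d 0 0)); rewrite dec.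
  have -> : d = const_mx (d 0 0).
    apply/matrixP => i j; rewrite ord1 mxE.
    by case: j => [[|[|//]] h]; [|rewrite dd]; congr (d _ _); exact/val_inj.
  by rewrite diag_const_mx mul_mx_scalar -scalemxAl SS' scalemx1 mxE.
have w0 a b : a != b -> (S *m M b *m (S *m M a)^H) 0 0 = 0.
  move=> ab; have := orthE _ _ ab; have := orth _ _ ab.
  have -> : \tr ((M a)^H *m M b) = \tr (diag_mx (const_mx 1) *m (S *m M b *m (S *m M a)^H)).
    rewrite diag_const_mx mul1mx adjmxM mxtrace_mulC mulmxA [RHS]mxtrace_mulC.
    by rewrite !mulmxA SS' mul1mx.
  have -> : \tr ((M a)^H *m E *m M b) = \tr (diag_mx d *m (S *m M b *m (S *m M a)^H)).
    have -> : (M a)^H *m E *m M b = (M a)^H *m S^H *m (diag_mx d *m (S *m M b)).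
      by rewrite dec !mulmxA.
    by rewrite [LHS]mxtrace_mulC adjmxM !mulmxA.
  rewrite !mxtrace_diag_mul !mxE !mul1r => /eqP; rewrite addr_eq0 => /eqP ->.
  rewrite mulrN addrC -mulrBl => /eqP; rewrite mulf_eq0 subr_eq0 eq_sym (negbTE d01) /=.
  by move=> /eqP ->; rewrite oppr0.
have [a ra] : exists a, row 0 S *m M a = 0.
  apply: orthogonal_rows3 => a b ab; apply/matrixP => i j; rewrite !ord1 [RHS]mxE.
  by rewrite -(w0 a b ab) -!row_mul !mxE; apply: eq_bigr => k _; rewrite !adjmxE !mxE.
exists a; apply/eqP/det0P; exists (row 0 S) => //.
apply/eqP => rS; have : row 0 S *m S^H = row 0 1%:M by rewrite -row_mul SS.
by rewrite rS mul0mx => /matrixP /(_ 0 0) /eqP; rewrite !mxE eqxx eq_sym oner_eq0.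
Qed.

Lemma locc_povm_psd k (t : locc R k) o : psd (locc_povm t o).
Proof.
elim: t => [lf | m K nx IH | m K nx IH] /=.
- by case: eqP => _; [exact: psd1|exact: psd0].
- by apply: psd_sum => j; exact: psd_congr.
- by apply: psd_sum => j; exact: psd_congr.
Qed.

Lemma adj_tensmx (K L : 'M[C]_2) : (tensmx K L)^H = tensmx K^H L^H.
Proof. by rewrite /adjmx map_mxT trmx_tens. Qed.

Lemma tens11 : tensmx (1%:M : 'M[C]_2) (1%:M : 'M[C]_2) = 1%:M.
Proof.
apply/matrixP => i j; case: (mxtens_indexP i) => i0 i1; case: (mxtens_indexP j) => j0 j1.
rewrite tensmxE !mxE (can_eq (@mxtens_indexK _ _)) xpair_eqE.
by case: eqP => _; rewrite ?mul0r // mul1r.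
Qed.

Lemma tensmx_suml (I : finType) (F : I -> 'M[C]_2) (B : 'M[C]_2) :
  \sum_i tensmx (F i) B = tensmx (\sum_i F i) B.
Proof.
apply/matrixP => i j; case: (mxtens_indexP i) => i0 i1; case: (mxtens_indexP j) => j0 j1.
by rewrite tensmxE !summxE mulr_suml; apply: eq_bigr => k _; rewrite tensmxE.
Qed.

Lemma tensmx_sumr (I : finType) (F : I -> 'M[C]_2) (B : 'M[C]_2) :
  \sum_i tensmx B (F i) = tensmx B (\sum_i F i).
Proof.
apply/matrixP => i j; case: (mxtens_indexP i) => i0 i1; case: (mxtens_indexP j) => j0 j1.
by rewrite tensmxE !summxE mulr_sumr; apply: eq_bigr => k _; rewrite tensmxE.
Qed.

Lemma locc_povm_sum k (t : locc R k) : locc_wf t -> \sum_o locc_povm t o = 1%:M.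
Proof.
elim: t => [lf | m K nx IH | m K nx IH] /=.
- by move=> _; rewrite -big_mkcond (big_pred1 lf) // => o; rewrite eq_sym.
- move=> [K1 wf]; rewrite exchange_big /=.
  under eq_bigr => j _ do rewrite -mulmx_suml -mulmx_sumr IH // mulmx1 adj_tensmx tensmx_mul adjmx1 mulmx1.
  by rewrite tensmx_suml K1 tens11.
- move=> [K1 wf]; rewrite exchange_big /=.
  under eq_bigr => j _ do rewrite -mulmx_suml -mulmx_sumr IH // mulmx1 adj_tensmx tensmx_mul adjmx1 mulmx1.
  by rewrite tensmx_sumr K1 tens11.
Qed.

Lemma psd_sum_mulmx0 n (I : finType) (F : I -> 'M[C]_n) (v : 'cV[C]_n) :
  (forall i, psd (F i)) -> (\sum_i F i) *m v = 0 -> forall i, F i *m v = 0.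
Proof.
move=> psdF Fv0 i; apply: psd_mulmx0 => //.
have : \sum_i (v^H *m F i *m v) 0 0 = 0.
  by rewrite -summxE -mulmx_suml -mulmx_sumr -mulmxA Fv0 mulmx0 mxE.
move/eqP; rewrite psumr_eq0 => [|j _]; last by have [_] := psdF j; exact.
by move=> /allP /(_ i (mem_index_enum i)) /eqP.
Qed.

Lemma psd_congr_mulmx0 n (A T : 'M[C]_n) (v : 'cV[C]_n) :
  psd A -> T^H *m A *m T *m v = 0 -> A *m (T *m v) = 0.
Proof.
move=> psdA h; apply: psd_mulmx0 => //.
by rewrite adjmxM -!mulmxA (mulmxA T^H) (mulmxA _ T) h mulmx0 mxE.
Qed.

(** Insert the sum of the [Pi o] between the two vectors: outcomes other than [b] annihilate
    [phi b], and outcome [b] annihilates [phi a]. *)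
Lemma discriminated_orth n k (Pi : 'I_k -> 'M[C]_n) (phi : 'I_k -> 'cV[C]_n) :
  (forall o, psd (Pi o)) -> \sum_o Pi o = 1%:M ->
  (forall a o, o != a -> Pi o *m phi a = 0) ->
  forall a b, a != b -> ((phi a)^H *m phi b) 0 0 = 0.
Proof.
move=> psdPi sumPi disc a b ab.
rewrite -[phi b]mul1mx -sumPi mulmx_suml mulmx_sumr summxE big1 // => o _.
case: (eqVneq o b) => [->|ob]; last by rewrite disc // mulmx0 mxE.
have [PiH _] := psdPi b; rewrite mulmxA -PiH -adjmxM disc 1?eq_sym //.
by rewrite adjmx0 mul0mx mxE.
Qed.

Lemma scalar_det_neq0 (K : 'M[C]_2) (c : C) : K^H *m K = c%:M -> c != 0 -> \det K != 0.
Proof.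
move=> KK c0; apply/eqP => dK; have := congr1 determinant KK.
by rewrite det_mulmx dK mulr0 det_scalar => /esym/eqP; rewrite expf_eq0 (negbTE c0).
Qed.

(** Either some outcome really disturbs the inner products, or some Kraus operator is a nonzero
    multiple of a unitary and can be undone. *)
Lemma exists_nontrivial m (K : 'I_m -> 'M[C]_2) :
  \sum_j (K j)^H *m K j = 1%:M ->
  (exists j, forall c, (K j)^H *m K j != c%:M) \/
  (exists j c, c != 0 /\ (K j)^H *m K j = c%:M).
Proof.
move=> K1; case: (pselect (exists j, forall c, (K j)^H *m K j != c%:M)); first by left.
move=> h; right; apply: contrapT => h2.
have K0 j : (K j)^H *m K j = 0.
  apply: contrapT => Kj; apply: h; exists j => c; apply/eqP => Kc.
  case: (eqVneq c 0) => [c0|c0]; last by apply: h2; exists j, c.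
  by apply: Kj; rewrite Kc c0 raddf0.
have /matrixP /(_ 0 0) : (1%:M : 'M[C]_2) = 0 by rewrite -K1 big1.
by rewrite !mxE => /eqP; rewrite oner_eq0.
Qed.

(* A round by one party acts by left multiplication by [K j] on the 2x2 coefficient matrix [N e]
   (up to transposition, which is why [N] is abstract). *)
Lemma local_round m (T : 'I_m -> 'M[C]_(2 * 2)) (K : 'I_m -> 'M[C]_2)
    (N : 'cV[C]_(2 * 2) -> 'M[C]_2) (Pi : 'I_m -> 'I_3 -> 'M[C]_(2 * 2)) :
  (forall e f, (e^H *m f) 0 0 = \tr ((N e)^H *m N f)) ->
  (forall j e, N (T j *m e) = K j *m N e) ->
  \sum_j (K j)^H *m K j = 1%:M ->
  (forall j o, psd (Pi j o)) -> (forall j, \sum_o Pi j o = 1%:M) ->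
  \sum_o \sum_j (T j)^H *m Pi j o *m T j = 1%:M ->
  (forall j phi, (forall a, phi a != 0) ->
     (forall a o, o != a -> Pi j o *m phi a = 0) -> exists a, \det (N (phi a)) = 0) ->
  forall phi, (forall a, phi a != 0) ->
    (forall a o, o != a -> (\sum_j (T j)^H *m Pi j o *m T j) *m phi a = 0) ->
  exists a, \det (N (phi a)) = 0.
Proof.
move=> formN NT K1 psdPi sumPi sumT IH phi phi0 disc.
have psdT j o : psd ((T j)^H *m Pi j o *m T j) by exact: psd_congr.
have orth := discriminated_orth (fun o => psd_sum (fun j => psdT j o)) sumT disc.
have discj j a o : o != a -> Pi j o *m (T j *m phi a) = 0.
  move=> oa; apply: psd_congr_mulmx0 => //.
  exact: (psd_sum_mulmx0 (fun j => psdT j o) (disc a o oa)).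
have [[j Kj]|[j [c [c0 Kj]]]] := exists_nontrivial K1.
  (* The vectors are orthogonal before the round, and also after outcome [j] because the rest of the
     protocol still discriminates them. This is the situation of [orthogonal_det0] with
     [E = K_j^H K_j]. *)
  have orthj := discriminated_orth (psdPi j) (sumPi j) (discj j).
  apply: (orthogonal_det0 _ Kj) => [|a b ab|a b ab].
  - by rewrite adjmxM adjmxK.
  - by rewrite -formN orth.
  - by rewrite -(orthj _ _ ab) formN !NT adjmxM !mulmxA.
(* Here [K j] is invertible: the images [T j *m phi a] stay nonzero, and a vanishing determinant for
   one of them passes back to [phi a]. *)
have [a|a] := IH j (fun a => T j *m phi a) _ (discj j).
  apply/eqP => Tphi; case/eqP: (phi0 a); apply: norm_eq0; apply: (mulfI c0).
  have : ((T j *m phi a)^H *m (T j *m phi a)) 0 0 = 0 by rewrite Tphi mulmx0 mxE.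
  rewrite formN NT adjmxM -mulmxA (mulmxA (K j)^H) Kj mul_scalar_mx -scalemxAr mxtraceZ.
  by rewrite -formN mulr0.
rewrite NT det_mulmx => /eqP; rewrite mulf_eq0 (negbTE (scalar_det_neq0 Kj c0)) /=.
by move=> /eqP; exists a.
Qed.

Theorem locc_discriminates_product (t : locc R 3) : locc_wf t ->
  forall phi : 'I_3 -> 'cV[C]_(2 * 2), (forall a, phi a != 0) ->
  (forall a o, o != a -> locc_povm t o *m phi a = 0) ->
  exists a, \det (unvec (phi a)) = 0.
Proof.
elim: t => [lf | m K nx IH | m K nx IH] wf phi phi0 disc.
(* A leaf always declares [lf], so it would have to annihilate a nonzero [phi a] with [a != lf]. *)
- have [a ao] : exists a : 'I_3, lf != a.
    by exists (if lf == 0 then 1 else 0); case: (eqVneq lf 0) => [->|].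
  by have := disc a lf ao; rewrite /= eqxx mul1mx => /eqP; rewrite (negbTE (phi0 a)).
- have sum1 := locc_povm_sum wf; case: wf => K1 wf.
  apply: (local_round form_unvec _ K1 (fun j => locc_povm_psd (nx j))
            (fun j => locc_povm_sum (wf j)) sum1 (fun j => IH j (wf j)) phi0 disc).
  by move=> j e; rewrite unvec_tens trmx1 mulmx1.
- have sum1 := locc_povm_sum wf; case: wf => K1 wf.
  have [|||a] := local_round (N := fun e => (unvec e)^T) _ _ K1
    (fun j => locc_povm_psd (nx j)) (fun j => locc_povm_sum (wf j)) sum1 _ phi0 disc.
  + move=> e f; rewrite form_unvec mxtrace_mulC -mxtrace_tr trmx_mul; congr (\tr (_ *m _)).
    by apply/matrixP => i j; rewrite !mxE.
  + by move=> j e; rewrite unvec_tens mul1mx trmx_mul trmxK.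
  + move=> j phi' phi'0 disc'; have [a da] := IH j (wf j) phi' phi'0 disc'.
    by exists a; rewrite det_tr.
  + by rewrite det_tr; exists a.
Qed.

End LoccProduct.

(** * A polynomial family of unitaries *)

Section TwistPolynomials.
Variable F : numClosedFieldType.
Implicit Types (z : F) (v : 'cV[F]_(2 * 2)) (a : 'I_(2 * 2) -> nat).

(** The Householder reflection [1 - 2 w w^T] for [w = (1,1,1,1)/2]: real orthogonal, with all
    entries equal to 1/2 or -1/2. *)
Definition hous (k l : 'I_(2 * 2)) : F := (k == l)%:R - 2^-1.

Lemma two_neq0 : (2 : F) != 0.
Proof. by rewrite pnatr_eq0. Qed.

Lemma hous_neq0 k l : hous k l != 0.
Proof.
rewrite /hous; case: (k == l); last by rewrite sub0r oppr_eq0 invr_eq0 two_neq0.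
have -> : (1 : F) - 2^-1 = 2^-1 by field; rewrite ?two_neq0.
by rewrite invr_eq0 two_neq0.
Qed.

Lemma hous_orth j l : \sum_k hous k j * hous k l = (j == l)%:R.
Proof.
have e k : hous k j * hous k l =
    (k == j)%:R * (k == l)%:R - 2^-1 * (k == j)%:R - 2^-1 * (k == l)%:R + 2^-1 * 2^-1.
  by rewrite /hous; ring.
under eq_bigr do rewrite e.
have sd i : \sum_(k < 2 * 2) (k == i)%:R = 1 :> F.
  by rewrite (bigD1 i) //= eqxx big1 ?addr0 // => k /negbTE ->.
have sdd : \sum_(k < 2 * 2) (k == j)%:R * (k == l)%:R = (j == l)%:R :> F.
  by rewrite (bigD1 j) //= eqxx mul1r big1 ?addr0 // => k /negbTE ->; rewrite mul0r.
rewrite !(big_split, sumrB) /= !sumrN -!mulr_sumr !sd sdd sumr_const card_ord.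
by rewrite -[_ *+ (2 * 2)]mulr_natl natrM; field; rewrite ?two_neq0.
Qed.

(* [twist a z = diag (z ^ a_k) H diag (z ^ l)], with [H = 1 - J / 2] a unitary without zero entry:
   the entries of [twist a z *m v] are polynomials in [z] that vanish identically only for [v = 0]. *)
Definition twist a z : 'M[F]_(2 * 2) :=
  \matrix_(k, l) (z ^+ a k * (hous k l * z ^+ l)).

Lemma twist_unitary a z : z * z^* = 1 ->
  map_mx (@Num.conj F) (twist a z)^T *m twist a z = 1%:M.
Proof.
move=> zz; have zzn m : (z ^+ m)^* * z ^+ m = 1.
  by rewrite rmorphXn -exprMn mulrC zz expr1n.
have conjM (x y : F) : (x * y)^* = x^* * y^* by exact: rmorphM.
have hc k l : (hous k l)^* = hous k l.
  by rewrite /hous rmorphB fmorphV !rmorph_nat.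
apply/matrixP => j l; rewrite !mxE.
transitivity ((z ^+ j)^* * z ^+ l * \sum_k hous k j * hous k l).
  rewrite mulr_sumr; apply: eq_bigr => k _; rewrite !mxE !conjM hc.
  rewrite -[RHS]mul1r -(zzn (a k)); ring.
rewrite hous_orth; case: eqP => [->|_]; last by rewrite mulr0.
by rewrite mulr1 zzn.
Qed.

Definition vpoly v (k : 'I_(2 * 2)) : {poly F} :=
  \poly_(l < 2 * 2) (hous k (inord l) * v (inord l) 0).

Definition tpoly a v k : {poly F} := 'X^(a k) * vpoly v k.

Lemma horner_tpoly a z v k : (tpoly a v k).[z] = (twist a z *m v) k 0.
Proof.
rewrite /tpoly hornerM hornerXn horner_poly mxE mulr_sumr; apply: eq_bigr => l _.
by rewrite !mxE inord_val; ring.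
Qed.

Lemma vpoly_neq0 v k : v != 0 -> vpoly v k != 0.
Proof.
apply: contra => /eqP vp; apply/eqP/matrixP => l j; rewrite ord1 mxE.
have := congr1 (fun p : {poly F} => p`_l) vp; rewrite coef_poly ltn_ord inord_val coef0.
by move=> /eqP; rewrite mulf_eq0 (negbTE (hous_neq0 _ _)) => /eqP.
Qed.

Lemma size_vpoly v k : (size (vpoly v k) <= 4)%N.
Proof. exact: size_poly. Qed.

Lemma size_mul_le (p q : {poly F}) m n :
  (size p <= m.+1)%N -> (size q <= n.+1)%N -> (size (p * q)%R <= (m + n).+1)%N.
Proof.
move=> sp sq; apply: leq_trans (size_polyMleq _ _) _.
by have := leq_add sp sq; rewrite addSn addnS; case: (_ + _)%N.
Qed.

Lemma size_add_le (p q : {poly F}) m :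
  (size p <= m)%N -> (size q <= m)%N -> (size (p + q)%R <= m)%N.
Proof. by move=> sp sq; rewrite (leq_trans (size_polyD _ _)) // geq_max sp. Qed.

(** A nonzero multiple of [X^m] has size greater than [m], so [q] cannot cancel it. This separates a
    leading product from the remaining terms of a determinant. *)
Lemma subr_Xn_neq0 m (p q : {poly F}) : p != 0 -> (size q <= m)%N -> 'X^m * p - q != 0.
Proof.
move=> p0 sq; rewrite subr_eq0; apply/eqP => e; move: sq; rewrite -e.
by rewrite mulrC size_mulXn // leqNgt -[X in (X < _)%N]addn0 ltn_add2l lt0n size_poly_eq0 p0.
Qed.

(** In the 2x2 determinant the off-diagonal product has degree at most 3 + 3 = 6, while the exponent
    7 makes the diagonal product a multiple of [X^7]. *)
Definition corner (k : 'I_(2 * 2)) : nat :=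
  if k == mxtens_index (0 : 'I_2, 0 : 'I_2) then 7%N else 0%N.

Definition detpoly v : {poly F} :=
  let t (i j : 'I_2) := tpoly corner v (mxtens_index (i, j)) in
  t 0 0 * t 1 1 - t 0 1 * t 1 0.

Lemma detpoly_neq0 v : v != 0 -> detpoly v != 0.
Proof.
move=> v0; rewrite /detpoly /tpoly /corner !(can_eq (@mxtens_indexK _ _)) !xpair_eqE /=.
rewrite !expr0 !mul1r -mulrA; apply: subr_Xn_neq0.
  by rewrite mulf_neq0 // vpoly_neq0.
by apply: (@size_mul_le _ _ 3 3); exact: size_vpoly.
Qed.

(** Degree at most 7 + 3 + 3 = 13, which bounds the number of parameters at which a given vector
    becomes a product. *)
Lemma size_detpoly v : (size (detpoly v) <= 14)%N.
Proof.
have sv := size_vpoly v.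
rewrite /detpoly /tpoly /corner !(can_eq (@mxtens_indexK _ _)) !xpair_eqE /=.
rewrite !expr0 !mul1r; apply: size_add_le; last rewrite size_polyN.
  apply: (@size_mul_le _ _ 10 3) => //; apply: (@size_mul_le _ _ 7 3) => //.
  by rewrite size_polyXn.
by apply: leq_trans (@size_mul_le _ _ 3 3 _ _) _.
Qed.

Definition low (j : 'I_3) : 'I_(2 * 2) := inord j.

(** Its nonvanishing is a sufficient polynomial condition for linear independence of three vectors
    of dimension 4. *)
Definition minor3 (v : 'I_3 -> 'cV[F]_(2 * 2)) : F :=
  \det (\matrix_(i < 3, j < 3) v i (low j) 0).

Lemma det_mx22 (T : comNzRingType) (M : 'M[T]_2) :
  \det M = M 0 0 * M 1 1 - M 0 1 * M 1 0.
Proof.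
rewrite (expand_det_row _ 0) !big_ord_recl big_ord0 addr0 /cofactor !det_mx11 !mxE.
have -> : lift 0 (0 : 'I_1) = 1 :> 'I_2 by exact/val_inj.
have -> : lift 1 (0 : 'I_1) = 0 :> 'I_2 by exact/val_inj.
by rewrite /= /bump /=; ring.
Qed.

Lemma horner_detpoly v z : (detpoly v).[z] =
  \det (\matrix_(i < 2, j < 2) (twist corner z *m v) (mxtens_index (i, j)) 0).
Proof.
rewrite det_mx22 /detpoly hornerD hornerN hornerM [X in _ - X]hornerM !horner_tpoly.
by congr (_ * _ - _ * _); rewrite [RHS]mxE.
Qed.

Lemma det_mx33 (T : comNzRingType) (M : 'M[T]_3) : \det M =
  M 0 0 * M 1 1 * M 2 2 - (M 0 0 * M 1 2 * M 2 1 + M 0 1 * M 1 0 * M 2 2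
   - M 0 1 * M 1 2 * M 2 0 - M 0 2 * M 1 0 * M 2 1 + M 0 2 * M 1 1 * M 2 0).
Proof.
rewrite (expand_det_row _ 0) !big_ord_recl big_ord0 addr0 /cofactor !det_mx22 !mxE.
have e1 : lift ord0 (ord0 : 'I_2) = 1 :> 'I_3 by exact/val_inj.
have e2 : lift ord0 (lift ord0 (ord0 : 'I_1)) = 2 :> 'I_3 by exact/val_inj.
have e3 : lift 1 (0 : 'I_2) = 0 :> 'I_3 by exact/val_inj.
have e4 : lift 1 (1 : 'I_2) = 2 :> 'I_3 by exact/val_inj.
have e5 : lift 2 (0 : 'I_2) = 0 :> 'I_3 by exact/val_inj.
have e6 : lift 2 (1 : 'I_2) = 1 :> 'I_3 by exact/val_inj.
have e7 : lift 0 (0 : 'I_2) = 1 :> 'I_3 by exact/val_inj.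
have e8 : lift 0 (1 : 'I_2) = 2 :> 'I_3 by exact/val_inj.
rewrite ?(e1, e2, e3, e4, e5, e6, e7, e8) /= /bump /=; ring.
Qed.

(** A separate unitary for each state. The diagonal product of the minor is a multiple of [X^15],
    while any other permutation fixes at most one index and contributes degree at most 5 + 9 =
    14. *)
Definition spike (i : 'I_3) (k : 'I_(2 * 2)) : nat := if k == low i then 5 else 0.

Definition minorpoly (v : 'I_3 -> 'cV[F]_(2 * 2)) : {poly F} :=
  \det (\matrix_(i < 3, j < 3) tpoly (spike i) (v i) (low j)).

Lemma horner_minorpoly (v : 'I_3 -> 'cV[F]_(2 * 2)) z :
  (minorpoly v).[z] = minor3 (fun i => twist (spike i) z *m v i).
Proof.
rewrite /minorpoly -[_.[z]]/(horner_eval z _) -det_map_mx; congr (\det _).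
apply/matrixP => i j; rewrite [LHS]mxE [RHS]mxE -horner_tpoly.
by congr (horner_eval z _); rewrite [LHS]mxE.
Qed.

Lemma low_inj : injective low.
Proof.
move=> i j /(congr1 val); rewrite /= !inordK; first exact: val_inj.
  exact: leq_trans (ltn_ord j) _.
exact: leq_trans (ltn_ord i) _.
Qed.

Lemma minorpoly_neq0 (v : 'I_3 -> 'cV[F]_(2 * 2)) : (forall i, v i != 0) -> minorpoly v != 0.
Proof.
move=> v0; rewrite /minorpoly det_mx33 !mxE /tpoly /spike !(inj_eq low_inj) /= !expr0 !mul1r.
set u := fun i j => vpoly (v i) (low j).
have su i j : (size (u i j) <= 4)%N by exact: size_vpoly.
have -> : 'X^5 * vpoly (v 0) (low 0) * ('X^5 * vpoly (v 1) (low 1)) * ('X^5 * vpoly (v 2) (low 2))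
   = 'X^15 * (u 0 0 * u 1 1 * u 2 2) :> {poly F}.
  by rewrite /u; ring.
apply: subr_Xn_neq0; first by rewrite !mulf_neq0 // vpoly_neq0.
have sX i j : (size ('X^5 * u i j)%R <= 9)%N.
  by apply: (@size_mul_le _ _ 5 3) => //; rewrite size_polyXn.
have s3 i j i' j' i'' j'' : (size (u i j * u i' j' * u i'' j'')%R <= 15)%N.
  apply: (@leq_trans 10) => //; apply: (@size_mul_le _ _ 6 3) => //.
  exact: (@size_mul_le _ _ 3 3).
have sX1 i j i' j' i'' j'' : (size ('X^5 * u i j * u i' j' * u i'' j'')%R <= 15)%N.
  apply: (@size_mul_le _ _ 11 3) => //; exact: (@size_mul_le _ _ 8 3).
have sX2 i j i' j' i'' j'' : (size (u i j * ('X^5 * u i' j') * u i'' j'')%R <= 15)%N.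
  apply: (@size_mul_le _ _ 11 3) => //; exact: (@size_mul_le _ _ 3 8).
have sX3 i j i' j' i'' j'' : (size (u i j * u i' j' * ('X^5 * u i'' j''))%R <= 15)%N.
  apply: (@size_mul_le _ _ 6 8) => //; exact: (@size_mul_le _ _ 3 3).
do 4 (apply: size_add_le; rewrite ?size_polyN; last by rewrite ?(s3, sX1, sX2, sX3)).
exact: sX1.
Qed.

Lemma size_minorpoly (v : 'I_3 -> 'cV[F]_(2 * 2)) : (size (minorpoly v) <= 28)%N.
Proof.
rewrite /minorpoly det_mx33 !mxE.
have st i j : (size (tpoly (spike i) (v i) (low j)) <= 9)%N.
  apply: (@size_mul_le _ _ 5 3); last exact: size_vpoly.
  by rewrite size_polyXn /spike; case: ifP.
have s3 i j i' j' i'' j'' : (size (tpoly (spike i) (v i) (low j) *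
   tpoly (spike i') (v i') (low j') * tpoly (spike i'') (v i'') (low j''))%R <= 28)%N.
  apply: (@leq_trans 25) => //; apply: (@size_mul_le _ _ 16 8) => //.
  exact: (@size_mul_le _ _ 8 8).
apply: size_add_le; first exact: s3.
rewrite size_polyN.
by do 4 (apply: size_add_le; rewrite ?size_polyN; last by rewrite ?s3).
Qed.

(** The Cayley transform of the real number [n]: an explicit infinite supply of distinct unit
    complex numbers. *)
Definition cayley (n : nat) : F := (1 + n%:R * 'i) / (1 - n%:R * 'i).

Lemma conj_cayley_num n : (1 + n%:R * 'i : F)^* = 1 - n%:R * 'i.
Proof.
have conjD (x y : F) : (x + y)^* = x^* + y^* by exact: rmorphD.
have conjM (x y : F) : (x * y)^* = x^* * y^* by exact: rmorphM.
by rewrite conjD conjM conjC1 conjCi conjC_nat mulrN.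
Qed.

Lemma cayley_neq0 n : (1 + n%:R * 'i : F) != 0 /\ (1 - n%:R * 'i : F) != 0.
Proof.
have h : (1 + n%:R * 'i : F) * (1 - n%:R * 'i) != 0.
  have -> : (1 + n%:R * 'i : F) * (1 - n%:R * 'i) = 1 - n%:R ^+ 2 * 'i ^+ 2 by ring.
  rewrite sqrCi mulrN1 opprK -natrX -[1]/(1%:R) -natrD pnatr_eq0 //.
by move: h; rewrite mulf_eq0 negb_or => /andP.
Qed.

Lemma cayley_unit n : cayley n * (cayley n)^* = 1.
Proof.
have [h1 h2] := cayley_neq0 n.
have conjM (x y : F) : (x * y)^* = x^* * y^* by exact: rmorphM.
have conjV (x : F) : (x^-1)^* = (x^*)^-1 by exact: fmorphV.
rewrite /cayley conjM conjV -conj_cayley_num conjCK conj_cayley_num.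
by rewrite mulrA divfK // divff.
Qed.

Lemma cayley_inj : injective cayley.
Proof.
move=> m n /eqP; have [h1 h2] := cayley_neq0 m; have [h3 h4] := cayley_neq0 n.
rewrite /cayley eqr_div // => /eqP e.
have : (m%:R - n%:R : F) * (2 * 'i) = 0.
  have -> : (m%:R - n%:R : F) * (2 * 'i) =
    (1 + m%:R * 'i) * (1 - n%:R * 'i) - (1 + n%:R * 'i) * (1 - m%:R * 'i) by ring.
  by rewrite e subrr.
move/eqP; rewrite mulf_eq0 mulf_eq0 (negbTE two_neq0) (negbTE (neq0Ci _)) !orbF subr_eq0.
by rewrite eqr_nat => /eqP.
Qed.

End TwistPolynomials.

(** * Null sets and measurability *)

Section MeasureTools.
Variable R : realType.

(** Integrating the number of [n < N] with [A (f n x)], which is at most [K] everywhere, gives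
    [N nu(A) <= K nu(T)] for every [N]. *)
Lemma null_of_finite_overlap d (T : measurableType d) (nu : {measure set T -> \bar R})
    (A : set T) (f : nat -> T -> T) (K : nat) :
  (nu setT < +oo)%E -> measurable A -> (forall n, measurable_fun setT (f n)) ->
  (forall n, nu (f n @^-1` A) = nu A) ->
  (forall x (s : seq nat), uniq s -> (forall n, n \in s -> A (f n x)) -> (size s <= K)%N) ->
  nu A = 0%E.
Proof.
move=> nufin mA mf nuf overlap.
have mfA n : measurable (f n @^-1` A).
  by rewrite -[X in measurable X]setTI; exact: mf.
have nuA : nu A \is a fin_num.
  by rewrite ge0_fin_numE // (le_lt_trans _ nufin) // le_measure ?inE.
have nuT : nu setT \is a fin_num by rewrite ge0_fin_numE.
have [b bE] : exists b, nu setT = b%:E by exists (fine (nu setT)); rewrite fineK.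
have [a aE] : exists a, nu A = a%:E by exists (fine (nu A)); rewrite fineK.
have le N : ((N%:R * a)%:E <= (K%:R)%:E * nu setT)%E.
  have -> : ((N%:R * a)%:E = \sum_(0 <= n < N) nu (f n @^-1` A))%E.
    rewrite [RHS](eq_bigr (fun _ => a%:E)) => [|n _]; last by rewrite -aE; exact: nuf.
    by rewrite sumEFin sumr_const_nat subn0 mulr_natl.
  have -> : (\sum_(0 <= n < N) nu (f n @^-1` A) =
            \int[nu]_x (\sum_(0 <= n < N) (\1_(f n @^-1` A) x)%:E))%E.
    rewrite ge0_integral_sum //.
    - by apply: eq_bigr => n _; rewrite integral_indic // setIT.
    - by move=> n; apply/measurable_EFinP; exact: measurable_indic.
  rewrite -(integral_cst nu measurableT); apply: ge0_le_integral => //.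
  - by move=> x _; rewrite sume_ge0 // => n _; rewrite lee_fin.
  - apply: emeasurable_sum => n.
    by apply/measurable_EFinP; exact: measurable_indic.
  move=> x _; rewrite sumEFin lee_fin.
  pose s := [seq n <- iota 0 N | `[< A (f n x) >]].
  have -> : \sum_(0 <= n < N) \1_(f n @^-1` A) x = (size s)%:R :> R.
    rewrite /s size_filter -sum1_count natr_sum [RHS]big_mkcond /index_iota subn0.
    apply: eq_bigr => n _; rewrite indicE.
    by case: asboolP => h; [rewrite mem_set|rewrite memNset].
  rewrite ler_nat; apply: (overlap x).
    by rewrite filter_uniq // iota_uniq.
  by move=> n; rewrite mem_filter => /andP [/asboolP].
have a0 : 0 <= a by rewrite -lee_fin -aE.
rewrite aE; congr EFin; apply/eqP; rewrite eq_le a0 andbT leNgt; apply/negP => apos.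
have := le (Num.truncn (K%:R * b / a)).+1.
rewrite bE -!EFinM lee_fin leNgt => /negP; apply.
by rewrite -ltr_pdivrMr // truncnS_gt.
Qed.

(** Computed through sections: [m2]-invariance replaces each section of the preimage by the section
    of [A] at [f1 x], and a change of variables along [f1] then concludes. *)
Lemma product_measure_preserving d1 d2 (T1 : measurableType d1) (T2 : measurableType d2)
    (m1 : {measure set T1 -> \bar R}) (m2 : {sigma_finite_measure set T2 -> \bar R})
    (f1 : T1 -> T1) (f2 : T2 -> T2) :
  measurable_fun setT f1 -> measurable_fun setT f2 ->
  (forall A, measurable A -> m1 (f1 @^-1` A) = m1 A) ->
  (forall A, measurable A -> m2 (f2 @^-1` A) = m2 A) ->
  forall A, measurable A ->
  (m1 \x m2)%E ((fun x => (f1 x.1, f2 x.2)) @^-1` A) = (m1 \x m2)%E A.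
Proof.
move=> mf1 mf2 m1f m2f A mA; rewrite /product_measure1 /=.
transitivity (\int[m1]_x ((m2 \o xsection A) (f1 x)))%E.
  apply: eq_integral => x _ /=; rewrite -[RHS]m2f; last exact: measurable_xsection.
  congr (m2 _); apply/seteqP; split=> y /=; by rewrite /xsection /= !inE.
have := @ge0_integral_pushforward _ _ _ _ R f1 mf1 m1 setT (m2 \o xsection A) measurableT.
rewrite preimage_setT => <- //; last exact: measurable_fun_xsection.
by apply: eq_measure_integral => B mB _; exact: m1f.
Qed.

(** The uncountable existential is replaced by countable operations. On a compact box a continuous
    function has a zero as soon as rational points make it arbitrarily small, so the sets [Q m] are
    squeezed between [E m] and [E m.+1]. *)
Lemma measurable_exists_zero d (T : measurableType d) n (F : T -> 'rV[R]_n -> R) :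
  (forall y, measurable_fun setT (F ^~ y)) -> (forall x, continuous (F x)) ->
  measurable [set x | exists y, F x y = 0].
Proof.
move=> mF cF.
pose box (r : R) := [set y : 'rV[R]_n | forall i, `|y ord0 i| <= r].
pose E m := [set x | exists2 y, box m%:R y & F x y = 0].
pose q (r : 'rV[rat]_n) : 'rV[R]_n := map_mx ratr r.
(* The box is enlarged by 1 because a rational approximation, taken within distance 1, may leave the
   box of [y]. *)
pose Q m := \bigcap_k \bigcup_(r in [set r : 'rV[rat]_n | box m.+1%:R (q r)])
              [set x | `|F x (q r)| < k.+1%:R^-1].
have mQ m : measurable (Q m).
  apply: bigcapT_measurable => k.
  rewrite bigcup_mkcond; apply: countable_bigcupT_measurable => [|r]; first exact: countableP.
  case: ifP => _ //.
  have mN : measurable_fun setT (fun x => `|F x (q r)|) by exact: measurableT_comp.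
  have -> : [set x | `|F x (q r)| < k.+1%:R^-1] =
      setT `&` (fun x => `|F x (q r)|) @^-1` `]-oo, k.+1%:R^-1[.
    by rewrite setTI; apply/seteqP; split=> x /=; rewrite in_itv.
  exact: mN.
have EQ m : E m `<=` Q m.
  move=> x [y yb Fy] k _.
  have e0 : (0 : R) < k.+1%:R^-1 by rewrite invr_gt0.
  have /nbhs_ballP [e /= ep eF] : \forall z \near y, `|F x z| < k.+1%:R^-1.
    have : F x @ y --> F x y by exact: cF.
    rewrite Fy => /cvgrPdist_lt /(_ _ e0).
    by apply: filterS => z; rewrite sub0r normrN.
  have dp : 0 < Num.min e 1 by rewrite lt_min ep ltr01.
  have ex i : exists r : rat, `|y ord0 i - ratr r| < Num.min e 1.
    have /rat_in_itvoo [r rI] : y ord0 i - Num.min e 1 < y ord0 i + Num.min e 1.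
      by rewrite ltrD2l gt0_cp.
    exists r; move: rI; rewrite in_itv /= ltr_distlC => /andP [a b].
    by rewrite a b.
  have [r rP] := choice ex.
  exists (\row_i r i) => /=.
    move=> i; rewrite !mxE; have := rP i; rewrite lt_min => /andP [_ ri].
    rewrite -[ratr _](subrK (y ord0 i)) -natr1 addrC (le_trans (ler_normD _ _)) //.
    by rewrite lerD // distrC ltW.
  apply: eF; split => // i j; rewrite !mxE ord1.
  by have := rP j; rewrite lt_min => /andP [].
have QE m : Q m `<=` E m.+1.
  move=> x Qx.
  have [r0 r0b _] := Qx 0%N I.
  have cbox : compact (box m.+1%:R).
    have := @rV_compact R n (fun _ => `[- m.+1%:R, m.+1%:R]%classic)
              (fun i => @segment_compact _ _ _).
    congr compact; apply/seteqP; split=> y h i; have := h i; rewrite /= in_itv /= ler_norml //.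
  have cN : {within box m.+1%:R, continuous (fun y => `|F x y|)}.
    apply: continuous_subspaceT => y.
    by apply: (@continuous_comp _ _ _ (F x) Num.norm); [exact: cF|exact: norm_continuous].
  have [c cb cmin] := compact_EVT_min (ex_intro (box m.+1%:R) (q r0) r0b) cbox cN.
  exists c; first by rewrite -in_setE.
  apply/eqP; rewrite -normr_le0 leNgt; apply/negP => Fc.
  (* At a nonzero minimum [|F x c|] this index satisfies [1 / k.+1 < |F x c|], so the rational point
     it provides would lie below the minimum. *)
  have [r rb] := Qx (Num.truncn (`|F x c|^-1)) I.
  apply/negP; rewrite /= -leNgt.
  apply: le_trans (cmin _ (mem_set rb)).
  by rewrite -[leRHS]invrK lef_pV2 ?posrE ?invr_gt0 // ltW // truncnS_gt.
rewrite (_ : [set x | _] = \bigcup_m Q m); first exact: bigcupT_measurable.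
apply/seteqP; split=> [x [y Fy]|x [m _ /QE [y _ Fy]]]; last by exists y.
exists (\max_(i < n) (Num.truncn `|y ord0 i|).+1)%N => //; apply: EQ; exists y => // i.
apply: (@le_trans _ _ (Num.truncn `|y ord0 i|).+1%:R); first by rewrite ltW // truncnS_gt.
by rewrite ler_nat; exact: (@leq_bigmax _ (fun i => (Num.truncn `|y ord0 i|).+1)).
Qed.

End MeasureTools.

(** * Closure of function algebras under complex matrix operations *)

Section ComplexClosure.
Variables (R : realType) (T : Type) (P : (T -> R) -> Prop).
Local Notation C := (R[i]).

(* Covers both measurable and continuous functions. *)
Definition function_algebra :=
  [/\ forall c, P (fun=> c), forall f g, P f -> P g -> P (fun t => f t + g t)
    & forall f g, P f -> P g -> P (fun t => f t * g t)].

Hypothesis algP : function_algebra.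

Definition complex_in (f : T -> C) := P (fun t => complex.Re (f t)) /\ P (fun t => complex.Im (f t)).
Definition mx_in m n (A : T -> 'M[C]_(m, n)) := forall i j, complex_in (fun t => A t i j).

Lemma alg_ext f g : f =1 g -> P f -> P g.
Proof. by move=> /funext ->. Qed.

Lemma alg_opp f : P f -> P (fun t => - f t).
Proof.
have [cP _ MP] := algP => Pf; apply: alg_ext (MP _ _ (cP (-1)) Pf) => t.
by rewrite mulN1r.
Qed.

Lemma alg_sum (I : finType) (f : I -> T -> R) :
  (forall i, P (f i)) -> P (fun t => \sum_i f i t).
Proof.
have [cP DP _] := algP => Pf.
suff h (s : seq I) : P (fun t => \sum_(i <- s) f i t) by exact: h.
elim: s => [|i s IH]; first by apply: alg_ext (cP 0) => t; rewrite big_nil.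
by apply: alg_ext (DP _ _ (Pf i) IH) => t; rewrite big_cons.
Qed.

Lemma complex_in_ext f g : f =1 g -> complex_in f -> complex_in g.
Proof. by move=> /funext ->. Qed.

Lemma complex_in_cst c : complex_in (fun=> c).
Proof. by have [cP _ _] := algP; split; exact: cP. Qed.

Lemma complex_inD f g : complex_in f -> complex_in g -> complex_in (fun t => f t + g t).
Proof.
have [_ DP _] := algP => -[f1 f2] [g1 g2]; split.
  by apply: alg_ext (DP _ _ f1 g1) => t; case: (f t) (g t) => a b [].
by apply: alg_ext (DP _ _ f2 g2) => t; case: (f t) (g t) => a b [].
Qed.

Lemma complex_inM f g : complex_in f -> complex_in g -> complex_in (fun t => f t * g t).
Proof.
have [_ DP MP] := algP => -[f1 f2] [g1 g2]; split.
  by apply: alg_ext (DP _ _ (MP _ _ f1 g1) (alg_opp (MP _ _ f2 g2))) => t; case: (f t) (g t) => a b [].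
by apply: alg_ext (DP _ _ (MP _ _ f1 g2) (MP _ _ f2 g1)) => t; case: (f t) (g t) => a b [].
Qed.

Lemma complex_in_conj f : complex_in f -> complex_in (fun t => (f t)^*).
Proof.
move=> [f1 f2]; split.
  by apply: alg_ext f1 => t; case: (f t).
by apply: alg_ext (alg_opp f2) => t; case: (f t).
Qed.

Lemma complex_in_sum (I : finType) (f : I -> T -> C) :
  (forall i, complex_in (f i)) -> complex_in (fun t => \sum_i f i t).
Proof.
move=> Pf; suff h (s : seq I) : complex_in (fun t => \sum_(i <- s) f i t) by exact: h.
elim: s => [|i s IH].
  by apply: complex_in_ext (complex_in_cst 0) => t; rewrite big_nil.
by apply: complex_in_ext (complex_inD (Pf i) IH) => t; rewrite big_cons.
Qed.

Lemma complex_in_prod (I : finType) (f : I -> T -> C) :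
  (forall i, complex_in (f i)) -> complex_in (fun t => \prod_i f i t).
Proof.
move=> Pf; suff h (s : seq I) : complex_in (fun t => \prod_(i <- s) f i t) by exact: h.
elim: s => [|i s IH].
  by apply: complex_in_ext (complex_in_cst 1) => t; rewrite big_nil.
by apply: complex_in_ext (complex_inM (Pf i) IH) => t; rewrite big_cons.
Qed.

Lemma mx_in_cst m n (A : 'M[C]_(m, n)) : mx_in (fun=> A).
Proof. by move=> i j; exact: complex_in_cst. Qed.

Lemma mx_inZ m n c (A : T -> 'M[C]_(m, n)) : mx_in A -> mx_in (fun t => c *: A t).
Proof.
move=> PA i j; apply: complex_in_ext (complex_inM (complex_in_cst c) (PA i j)) => t.
by rewrite mxE.
Qed.

Lemma mx_inB m n (A B : T -> 'M[C]_(m, n)) :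
  mx_in A -> mx_in B -> mx_in (fun t => A t - B t).
Proof.
move=> PA PB i j; have PNB := complex_inM (complex_in_cst (-1)) (PB i j).
by apply: complex_in_ext (complex_inD (PA i j) PNB) => t; rewrite !mxE mulN1r.
Qed.

Lemma mx_in_sum m n (I : finType) (A : I -> T -> 'M[C]_(m, n)) :
  (forall i, mx_in (A i)) -> mx_in (fun t => \sum_i A i t).
Proof.
move=> PA i j; apply: complex_in_ext (complex_in_sum (fun k => PA k i j)) => t.
by rewrite summxE.
Qed.

Lemma mx_inM m n q (A : T -> 'M[C]_(m, n)) (B : T -> 'M[C]_(n, q)) :
  mx_in A -> mx_in B -> mx_in (fun t => A t *m B t).
Proof.
move=> PA PB i j.
apply: complex_in_ext (complex_in_sum (fun k => complex_inM (PA i k) (PB k j))) => t.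
by rewrite mxE.
Qed.

Lemma mx_in_adj m n (A : T -> 'M[C]_(m, n)) : mx_in A -> mx_in (fun t => (A t)^H).
Proof.
move=> PA i j; apply: complex_in_ext (complex_in_conj (PA j i)) => t.
by rewrite adjmxE.
Qed.

Lemma complex_in_det n (A : T -> 'M[C]_n) : mx_in A -> complex_in (fun t => \det (A t)).
Proof.
move=> PA; apply: complex_in_sum => s.
apply: complex_inM; first exact: complex_in_cst.
by apply: complex_in_prod => i; exact: PA.
Qed.

Definition sqnorm m n (A : 'M[C]_(m, n)) : R :=
  \sum_i \sum_j (complex.Re (A i j) ^+ 2 + complex.Im (A i j) ^+ 2).

Lemma alg_sqnorm m n (A : T -> 'M[C]_(m, n)) : mx_in A -> P (fun t => sqnorm (A t)).
Proof.
have [_ DP MP] := algP => PA; apply: alg_sum => i; apply: alg_sum => j.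
by have [h1 h2] := PA i j; apply: DP; exact: MP.
Qed.

End ComplexClosure.

(** * Stationarity as the zero set of a real polynomial *)

Section Residual.
Variable R : realType.
Local Notation C := (R[i]).

Lemma sqnorm_ge0 m n (A : 'M[C]_(m, n)) : 0 <= sqnorm A.
Proof. by do 2 apply: sumr_ge0 => ? _; rewrite addr_ge0 // sqr_ge0. Qed.

Lemma sqnorm_eq0 m n (A : 'M[C]_(m, n)) : (sqnorm A == 0) = (A == 0).
Proof.
apply/eqP/eqP => [|->]; last first.
  by rewrite /sqnorm !big1 // => i _; rewrite big1 // => j _; rewrite !mxE /= expr0n addr0.
move=> /eqP; rewrite psumr_eq0 => [/allP h|i _]; last first.
  by apply: sumr_ge0 => ? _; rewrite addr_ge0 // sqr_ge0.
apply/matrixP => i j; have := h i (mem_index_enum i); rewrite /= psumr_eq0 => [|k _]; last first.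
  by rewrite addr_ge0 // sqr_ge0.
move=> /allP /(_ j (mem_index_enum j)) /=; rewrite paddr_eq0 ?sqr_ge0 // !sqrf_eq0 mxE.
by case: (A i j) => a b /= /andP [/eqP -> /eqP ->].
Qed.

Variable p : 'I_3 -> R.
Local Notation pc i := (real_complex R (p i)).
Local Notation N := (2 * 2)%N.

(* A polynomial whose zeros encode stationarity (with [K j] a Gram factor of the [j]-th dual slack)
   together with a vanishing 2x2 determinant. *)
Definition residual (psi phi : 'I_3 -> 'cV[C]_N) (K : 'I_3 -> 'M[C]_N) : R :=
  \sum_i \sum_j sqnorm (if i == j then (phi i)^H *m phi i - (psi i)^H *m phi i
                        else (phi i)^H *m phi j)
  + sqnorm ((lambda p psi phi)^H - lambda p psi phi)
  + \sum_j sqnorm (lambda p psi phi - pc j *: (psi j *m (psi j)^H) - (K j)^H *m K j)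
  + sqnorm ((\prod_a \det (unvec (phi a)))%:M : 'M[C]_1).

(** All summands are nonnegative, so each vanishes. Positivity of a slack is the existence of its
    Gram factor, and the product of determinants encodes the existence of [a]. *)
Lemma residual_eq0 psi phi :
  (exists K, residual psi phi K = 0) <->
  stationary p psi phi /\ exists a, \det (unvec (phi a)) = 0.
Proof.
have e1 K : (residual psi phi K == 0) =
  [&& [forall i, forall j, (if i == j then (phi i)^H *m phi i - (psi i)^H *m phi i
                        else (phi i)^H *m phi j) == 0],
   (lambda p psi phi)^H - lambda p psi phi == 0,
   [forall j, lambda p psi phi - pc j *: (psi j *m (psi j)^H) - (K j)^H *m K j == 0]
   & \prod_a \det (unvec (phi a)) == 0].
  have sum_ge0 (I : finType) (f : I -> R) : (forall i, 0 <= f i) -> 0 <= \sum_i f i.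
    by move=> f0; apply: sumr_ge0.
  have sum_eq0 (I : finType) (f : I -> R) : (forall i, 0 <= f i) ->
      (\sum_i f i == 0) = [forall i, f i == 0].
    move=> f0; rewrite psumr_eq0 //; apply/allP/forallP => h i; last by move=> _; exact: h.
    exact: h (mem_index_enum i).
  have sum4 (w x y z : R) : 0 <= w -> 0 <= x -> 0 <= y -> 0 <= z ->
      (w + x + y + z == 0) = [&& w == 0, x == 0, y == 0 & z == 0].
    by move=> w0 x0 y0 z0; rewrite !paddr_eq0 ?addr_ge0 // -!andbA.
  rewrite /residual sum4 ?sqnorm_ge0 //; last first.
  - by apply: sum_ge0 => j; exact: sqnorm_ge0.
  - by apply: (sum_ge0) => i; apply: (sum_ge0) => j; exact: sqnorm_ge0.
  rewrite !sqnorm_eq0; congr [&& _, _, _ & _].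
  - rewrite sum_eq0 => [|i]; last by apply: sum_ge0 => j; exact: sqnorm_ge0.
    apply: eq_forallb => i; rewrite sum_eq0 => [|j]; last exact: sqnorm_ge0.
    by apply: eq_forallb => j; rewrite sqnorm_eq0.
  - rewrite sum_eq0 => [|j]; last exact: sqnorm_ge0.
    by apply: eq_forallb => j; rewrite sqnorm_eq0.
  - apply/eqP/eqP => [/matrixP /(_ 0 0)|->]; last by rewrite raddf0.
    by rewrite !mxE.
split=> [[K /eqP]|[[orth sqE LH psdL] [a da]]].
  rewrite e1 => /and4P [/forallP h1 /eqP h2 /forallP h3 h4].
  split; last first.
    have /prodf_eq0 [a _ /eqP da] := h4; by exists a.
  split=> [i j ij|i||j].
  - by have /forallP /(_ j) := h1 i; rewrite (negbTE ij) => /eqP ->; rewrite mxE.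
  - have /forallP /(_ i) := h1 i; rewrite eqxx subr_eq0 => /eqP ->. by [].
  - by apply/eqP; rewrite -subr_eq0 h2.
  - by have := h3 j; rewrite subr_eq0 => /eqP ->; exact: psd_gram.
have /choice [K KE] : forall j, exists K : 'M[C]_N,
    lambda p psi phi - pc j *: (psi j *m (psi j)^H) = K^H *m K.
  by move=> j; have /psdP [K] := psdL j; exists K.
exists K; apply/eqP; rewrite e1; apply/and4P; split.
- apply/forallP => i; apply/forallP => j; case: (eqVneq i j) => [_|ij].
    by rewrite subr_eq0; apply/eqP/matrixP => x y; rewrite !ord1 sqE.
  by apply/eqP/matrixP => x y; rewrite !ord1 orth // mxE.
- by rewrite LH subrr.
- by apply/forallP => j; rewrite KE subrr.
- by apply/prodf_eq0; exists a => //; apply/eqP.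
Qed.

(** Stated for any function algebra because it serves twice: measurability in the states, and
    continuity in the unknowns [phi] and [K]. *)
Lemma alg_residual T (P : (T -> R) -> Prop) (psi phi : T -> 'I_3 -> 'cV[C]_N)
    (K : T -> 'I_3 -> 'M[C]_N) : function_algebra P ->
  (forall i, mx_in P (fun t => psi t i)) -> (forall i, mx_in P (fun t => phi t i)) ->
  (forall i, mx_in P (fun t => K t i)) ->
  P (fun t => residual (psi t) (phi t) (K t)).
Proof.
move=> algP Ppsi Pphi PK; have [_ DP _] := algP.
have PL : mx_in P (fun t => lambda p (psi t) (phi t)).
  apply: mx_in_sum => // i; apply: mx_inZ => //; apply: mx_inM => //.
  exact: mx_in_adj.
rewrite /residual; refine (DP _ _ (DP _ _ (DP _ _ _ _) _) _).
- apply: alg_sum => // i; apply: alg_sum => // j; apply: alg_sqnorm => //.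
  case: eqP => _; last by apply: mx_inM => //; exact: mx_in_adj.
  by apply: mx_inB => //; apply: mx_inM => //; exact: mx_in_adj.
- by apply: alg_sqnorm => //; apply: mx_inB => //; exact: mx_in_adj.
- apply: alg_sum => // j; apply: alg_sqnorm => //; apply: mx_inB => //.
    by apply: mx_inB => //; apply: mx_inZ => //; apply: mx_inM => //; exact: mx_in_adj.
  by apply: mx_inM => //; exact: mx_in_adj.
- apply: alg_sqnorm => // i j.
  have h : complex_in P (fun t => \prod_a \det (unvec (phi t a))).
    apply: complex_in_prod => // a; apply: complex_in_det => // x y.
    by apply: complex_in_ext (Pphi a (mxtens_index (x, y)) 0) => t; rewrite mxE.
  by apply: complex_in_ext h => t; rewrite !ord1 mxE eqxx.
Qed.

Lemma measurable_algebra d (T : measurableType d) :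
  function_algebra (fun f : T -> R => measurable_fun setT f).
Proof.
split=> [c|f g|f g]; first exact: measurable_cst.
  exact: measurable_funD.
exact: measurable_funM.
Qed.

Lemma continuous_algebra (T : topologicalType) :
  function_algebra (fun f : T -> R => continuous f).
Proof.
split=> [c|f g cf cg|f g cf cg] x; first exact: cst_continuous.
  by apply: continuousD; [exact: cf|exact: cg].
by apply: continuousM; [exact: cf|exact: cg].
Qed.

(** The complex entries of all [phi i] and [K i] are packed into one real row vector; the boolean
    selects the real (false) or imaginary (true) part. *)
Local Notation slot := ('I_3 * 'I_N + 'I_3 * 'I_N * 'I_N)%type.
Local Notation dim := #|{: slot * bool}|.

Definition decode (y : 'rV[R]_dim) (s : slot) : C :=
  Complex (y 0 (enum_rank (s, false))) (y 0 (enum_rank (s, true))).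

Lemma decode_surj (g : slot -> C) : exists y, decode y = g.
Proof.
exists (\row_k let: (s, b) := enum_val k in if b then complex.Im (g s) else complex.Re (g s)).
by apply/funext => s; rewrite /decode !mxE !enum_rankK; case: (g s).
Qed.

Lemma continuous_decode s : complex_in (fun f : 'rV[R]_dim -> R => continuous f) (decode ^~ s).
Proof. by split=> /=; exact: coord_continuous. Qed.

Lemma measurable_stationary d (T : measurableType d) (psi : T -> 'I_3 -> 'cV[C]_N) :
  (forall i, mx_in (fun f : T -> R => measurable_fun setT f) (fun t => psi t i)) ->
  measurable [set t | exists phi, stationary p (psi t) phi /\ exists a, \det (unvec (phi a)) = 0].
Proof.
move=> mpsi.
pose phiof (y : 'rV[R]_dim) i : 'cV[C]_N := \col_k decode y (inl (i, k)).
pose Kof (y : 'rV[R]_dim) i : 'M[C]_N := \matrix_(k, l) decode y (inr (i, k, l)).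
rewrite (_ : [set t | _] = [set t | exists y, residual (psi t) (phiof y) (Kof y) = 0]).
  apply: (measurable_exists_zero (F := fun t y => residual (psi t) (phiof y) (Kof y))) => [y|t].
    apply: (alg_residual (measurable_algebra T) mpsi) => i.
      exact: (mx_in_cst (measurable_algebra T) (phiof y i)).
    exact: (mx_in_cst (measurable_algebra T) (Kof y i)).
  apply: (alg_residual (P := fun f : 'rV[R]_dim -> R => continuous f)).
  - exact: continuous_algebra.
  - by move=> i; exact: (mx_in_cst (continuous_algebra _) (psi t i)).
  - move=> i k l; apply: complex_in_ext (continuous_decode (inl (i, k))) => y.
    by rewrite mxE.
  - move=> i k l; apply: complex_in_ext (continuous_decode (inr (i, k, l))) => y.
    by rewrite mxE.
apply/seteqP; split=> t /= [].
  move=> phi /residual_eq0 [K res0].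
  have [y yE] := decode_surj (fun s => match s with
    inl (i, k) => phi i k 0 | inr (i, k, l) => K i k l end).
  exists y; rewrite (_ : phiof y = phi) 1?(_ : Kof y = K) //.
    by apply/funext => i; apply/matrixP => k l; rewrite mxE yE.
  by apply/funext => i; apply/matrixP => k l; rewrite mxE yE ord1.
move=> y res0; exists (phiof y); apply/residual_eq0; by exists (Kof y).
Qed.

End Residual.

(** * Haar-random triples *)

Section HaarTriples.
Variable R : realType.
Local Notation C := (R[i]).
Local Notation N := (2 * 2)%N.
Local Notation X := ((CMat R * CMat R) * CMat R)%type.

Lemma mx_coordE (i j : 'I_N) (b : bool) : exists k : 'I_32, forall A : 'M[C]_N,
  mx_coord k A = if b then complex.Im (A i j) else complex.Re (A i j).
Proof.
(* The index [8 i + 2 j + b] is the one that the divisions and the parity test in [mx_coord] decode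
   to [i], [j] and [b]. *)
have lt : (8 * i + 2 * j + b < 32)%N.
  by case: i j b => [[|[|[|[|//]]]] hi] [[|[|[|[|//]]]] hj] [].
exists (Ordinal lt) => A; rewrite /mx_coord /=.
have -> : odd (8 * i + 2 * j + b) = b by case: i j b {lt} => [[|[|[|[|//]]]] hi] [[|[|[|[|//]]]] hj] [].
suff [-> ->] : inord ((8 * i + 2 * j + b) %/ 8) = i :> 'I_N /\
               inord ((8 * i + 2 * j + b) %/ 2 %% 4) = j :> 'I_N by [].
by split; apply: val_inj; rewrite /= inordK;
  case: i j b {lt} => [[|[|[|[|//]]]] hi] [[|[|[|[|//]]]] hj] [].
Qed.

Lemma measurable_mx_coord k : measurable_fun setT (mx_coord k : CMat R -> R).
Proof.
move=> _ Y mY; rewrite setTI; do 2 apply: sub_sigma_algebra => /=.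
rewrite -bigcup_seq /=; exists k => /=; first by rewrite mem_index_enum.
by exists Y => //; rewrite setTI.
Qed.

Section ToCMat.
Context d (T : measurableType d).
Local Notation meas := (fun f : T -> R => measurable_fun setT f).

Lemma mx_in_CMat (f : T -> CMat R) : measurable_fun setT f ->
  mx_in meas (f : T -> 'M[C]_N).
Proof.
move=> mf i j; split.
  have [k kE] := mx_coordE i j false.
  have := measurableT_comp (measurable_mx_coord k) mf.
  by congr (measurable_fun _ _); apply/funext => t /=; rewrite kE.
have [k kE] := mx_coordE i j true.
have := measurableT_comp (measurable_mx_coord k) mf.
by congr (measurable_fun _ _); apply/funext => t /=; rewrite kE.
Qed.

Lemma measurable_CMat (f : T -> CMat R) : mx_in meas (f : T -> 'M[C]_N) ->
  measurable_fun setT f.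
Proof.
move=> mf.
have sub : g_sigma_preimage (fun k => (mx_coord k : mx44 R -> R) \o f) `<=` measurable.
  apply: smallest_sub; first exact: sigma_algebra_measurable.
  rewrite -bigcup_mkord_ord; apply: bigcup_sub => k _ A [B mB <-].
  have mk (l : 'I_32) : measurable_fun setT ((mx_coord l : mx44 R -> R) \o f).
    have [m1 m2] := mf (inord (l %/ 8)) (inord ((l %/ 2) %% 4)).
    by rewrite /mx_coord /comp; case: (odd l).
  exact: mk.
rewrite g_sigma_preimage_comp in sub.
pose G : set (set (CMat R)) := g_sigma_preimage (@mx_coord R : 'I_32 -> mx44 R -> R).
by apply: (measurability G).
Qed.

End ToCMat.

Lemma measurable_mulmx (V : 'M[C]_N) :
  measurable_fun setT (fun U : CMat R => V *m U : CMat R).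
Proof.
have algP := measurable_algebra R (CMat R).
apply: measurable_CMat; apply: (mx_inM algP); first exact: (mx_in_cst algP V).
exact: mx_in_CMat.
Qed.

Definition states (U : X) (i : 'I_3) : 'cV[C]_N :=
  ([:: U.1.1; U.1.2; U.2] : seq 'M[C]_N)`_i *m ket00 R.

Lemma states_measurable i :
  mx_in (fun f : X -> R => measurable_fun setT f) (fun U => states U i).
Proof.
have algP := measurable_algebra R X.
apply: (mx_inM algP); last exact: (mx_in_cst algP (ket00 R)).
case: i => [[|[|[|//]]] hi] /=; apply: mx_in_CMat.
- exact: (measurableT_comp measurable_fst measurable_fst).
- exact: (measurableT_comp measurable_snd measurable_fst).
- exact: measurable_snd.
Qed.

Definition all_unitary (U : X) := [/\ unitary U.1.1, unitary U.1.2 & unitary U.2].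

Definition act (a b c : 'I_N -> nat) (n : nat) (U : X) : X :=
  ((twist a (cayley C n) *m U.1.1 : CMat R, twist b (cayley C n) *m U.1.2 : CMat R),
   twist c (cayley C n) *m U.2 : CMat R).

Lemma measurable_act a b c n : measurable_fun setT (act a b c n).
Proof.
apply: measurable_fun_pair; first apply: measurable_fun_pair.
- apply: (measurableT_comp (measurable_mulmx _)).
  exact: (measurableT_comp measurable_fst measurable_fst).
- apply: (measurableT_comp (measurable_mulmx _)).
  exact: (measurableT_comp measurable_snd measurable_fst).
- exact: (measurableT_comp (measurable_mulmx _) measurable_snd).
Qed.

Lemma twist_adj a n : (twist a (cayley C n))^H *m twist a (cayley C n) = 1%:M :> 'M[C]_N.
Proof. by rewrite adjmx_trC twist_unitary // cayley_unit. Qed.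

Lemma unitary_measurable d (T : measurableType d) (f : T -> CMat R) :
  measurable_fun setT f -> measurable [set t | unitary (f t : 'M[C]_N)].
Proof.
move=> mf; have algP := measurable_algebra R T.
have mF : mx_in (fun g : T -> R => measurable_fun setT g)
    (fun t => (f t : 'M[C]_N) *m (f t : 'M[C]_N)^H - 1%:M).
  apply: (mx_inB algP); last exact: (mx_in_cst algP 1%:M).
  by apply: (mx_inM algP); last apply: (mx_in_adj algP); exact: mx_in_CMat.
have := alg_sqnorm algP mF => /(_ measurableT _ (measurable_set1 0)).
rewrite setTI; congr measurable; apply/seteqP; split=> t /=.
  by move=> /eqP; rewrite sqnorm_eq0 subr_eq0 => /eqP.
by rewrite /unitary => h; apply/eqP; rewrite sqnorm_eq0 subr_eq0 h.
Qed.

Lemma minor3_measurable :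
  complex_in (fun f : X -> R => measurable_fun setT f) (fun U => minor3 (states U)).
Proof.
have algP := measurable_algebra R X.
apply: (complex_in_det algP) => i j.
by apply: complex_in_ext (states_measurable i (low j) 0) => U; rewrite [RHS]mxE.
Qed.

Lemma minor3_zero_measurable : measurable [set U : X | minor3 (states U) = 0].
Proof.
have algP := measurable_algebra R X; have [m1 m2] := minor3_measurable.
have -> : [set U : X | minor3 (states U) = 0] =
    (setT `&` (fun U : X => complex.Re (minor3 (states U))) @^-1` [set 0]) `&`
    (setT `&` (fun U : X => complex.Im (minor3 (states U))) @^-1` [set 0]).
  rewrite !setTI; apply/seteqP; split=> U /=; first by move=> ->.
  by case: (minor3 _) => x y /= [-> ->].
by apply: measurableI; [exact: m1|exact: m2].
Qed.

Lemma all_unitary_measurable : measurable [set U : X | all_unitary U].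
Proof.
have -> : [set U : X | all_unitary U] = [set U : X | unitary (U.1.1 : 'M[C]_N)] `&`
    [set U : X | unitary (U.1.2 : 'M[C]_N)] `&` [set U : X | unitary (U.2 : 'M[C]_N)].
  by apply/seteqP; split=> U /= [] //= [].
apply: measurableI; first apply: measurableI; apply: unitary_measurable.
- exact: (measurableT_comp measurable_fst measurable_fst).
- exact: (measurableT_comp measurable_snd measurable_fst).
- exact: measurable_snd.
Qed.

(** Restricting to unitary triples keeps all three states nonzero, so that [minorpoly] is a nonzero
    polynomial. *)
Definition dependent := [set U : X | all_unitary U] `&` [set U | minor3 (states U) = 0].

Lemma dependent_measurable : measurable dependent.
Proof.
by apply: measurableI; [exact: all_unitary_measurable|exact: minor3_zero_measurable].
Qed.

Variable mu : probability (CMat R) R.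
Hypothesis mu_haar : haar_measure mu.
Local Notation nu := ((mu \x mu) \x mu)%E.

(** Haar invariance speaks of images; the preimage under [V] is the image under [V^H]. *)
Lemma haar_preimage (V : 'M[C]_N) (A : set (CMat R)) : V^H *m V = 1%:M -> measurable A ->
  mu ((fun U : CMat R => V *m U : CMat R) @^-1` A) = mu A.
Proof.
move=> VV mA; have VV' : V *m V^H = 1%:M by exact: mulmx1C.
have [_ /(_ V^H A) inv] := mu_haar.
rewrite -inv //; last by rewrite /unitary adjmxK.
congr (mu _); apply/seteqP; split=> U /=.
  by move=> AU; exists (V *m U) => //; rewrite mulmxA VV mul1mx.
by move=> [W AW <-]; rewrite mulmxA VV' mul1mx.
Qed.

Lemma act_preserving a b c n (A : set X) : measurable A -> nu (act a b c n @^-1` A) = nu A.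
Proof.
move=> mA.
have h V : V^H *m V = 1%:M -> forall B, measurable B ->
    mu ((fun U : CMat R => V *m U : CMat R) @^-1` B) = mu B.
  by move=> VV B; exact: haar_preimage.
rewrite -(product_measure_preserving (m1 := (mu \x mu)%E) (m2 := mu)
  (f1 := fun x => (twist a (cayley C n) *m x.1 : CMat R, twist b (cayley C n) *m x.2 : CMat R))
  (f2 := fun U => twist c (cayley C n) *m U : CMat R) _ (measurable_mulmx _) _ _ mA) //.
- apply: measurable_fun_pair.
    exact: (measurableT_comp (measurable_mulmx _) measurable_fst).
  exact: (measurableT_comp (measurable_mulmx _) measurable_snd).
- move=> B mB.
  apply: (product_measure_preserving (m1 := mu) (m2 := mu) (measurable_mulmx _)
            (measurable_mulmx _) (h _ (twist_adj a n)) (h _ (twist_adj b n)) mB).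
- exact: h (twist_adj c n).
Qed.

Lemma nu_setT : nu setT = 1%E.
Proof.
have muT : mu setT = 1%E by exact: probability_setT.
have e1 : (mu \x mu)%E (setT `*` setT) = (mu setT * mu setT)%E by exact: product_measure1E.
have e2 : nu (setT `*` setT) = ((mu \x mu)%E setT * mu setT)%E by exact: product_measure1E.
by rewrite -setXTT e2 muT mule1 -setXTT e1 muT mule1.
Qed.

Lemma negligible_nonunitary : nu.-negligible (~` [set U | all_unitary U]).
Proof.
have mU : measurable [set U : CMat R | unitary (U : 'M[C]_N)].
  exact: (unitary_measurable (f := fun U : CMat R => U)).
have muC : mu (~` [set U : CMat R | unitary (U : 'M[C]_N)]) = 0%E.
  rewrite probability_setC //; have [-> _] := mu_haar; by rewrite subee.
set S := [set U : CMat R | _] in mU muC.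
have -> : ~` [set U | all_unitary U] =
    (~` S `*` setT) `*` setT `|` (setT `*` ~` S) `*` setT `|` setT `*` ~` S :> set X.
  apply/seteqP; split=> -[[u v] w] /=.
    move=> h; case: (pselect (S u)) => su; last by left; left.
    case: (pselect (S v)) => sv; last by left; right.
    by right; split => // sw; apply: h.
  by move=> [[[[h _] _]|[[_ h] _]]|[_ h]] [].
have mSC : measurable (~` S) by exact: measurableC.
have n1 A B : measurable A -> measurable B -> mu A = 0%E -> (mu \x mu)%E (A `*` B) = 0%E.
  move=> mA mB A0; have -> : (mu \x mu)%E (A `*` B) = (mu A * mu B)%E by exact: product_measure1E.
  by rewrite A0 mul0e.
have n2 A B : measurable A -> measurable B -> mu B = 0%E -> (mu \x mu)%E (A `*` B) = 0%E.
  move=> mA mB B0; have -> : (mu \x mu)%E (A `*` B) = (mu A * mu B)%E by exact: product_measure1E.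
  by rewrite B0 mule0.
have n3 A B : measurable A -> measurable B -> (mu \x mu)%E A = 0%E -> nu (A `*` B) = 0%E.
  move=> mA mB A0; have -> : nu (A `*` B) = ((mu \x mu)%E A * mu B)%E by exact: product_measure1E.
  by rewrite A0 mul0e.
have n4 A B : measurable A -> measurable B -> mu B = 0%E -> nu (A `*` B) = 0%E.
  move=> mA mB B0; have -> : nu (A `*` B) = ((mu \x mu)%E A * mu B)%E by exact: product_measure1E.
  by rewrite B0 mule0.
have m1 : measurable (~` S `*` setT : set (CMat R * CMat R)) by exact: measurableX.
have m2 : measurable (setT `*` ~` S : set (CMat R * CMat R)) by exact: measurableX.
apply: negligibleU; first apply: negligibleU.
- by apply/negligibleP; [exact: measurableX|apply: n3 => //; exact: n1].
- by apply/negligibleP; [exact: measurableX|apply: n3 => //; exact: n2].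
- by apply/negligibleP; [exact: measurableX|exact: n4].
Qed.

Lemma ord3P (i : 'I_3) : i = 0 \/ i = 1 \/ i = 2.
Proof.
by case: i => [[|[|[|//]]] hi]; [left|right; left|right; right]; exact: val_inj.
Qed.

Lemma states_act (a : 'I_3 -> 'I_N -> nat) n U i :
  states (act (a 0) (a 1) (a 2) n U) i = twist (a i) (cayley C n) *m states U i.
Proof.
by have [-> | [-> | ->]] := ord3P i; rewrite /states /= mulmxA.
Qed.

Lemma unitary_col_neq0 (U : 'M[C]_N) : unitary U -> U *m ket00 R != 0.
Proof.
move=> /mulmx1C UU; apply/eqP => /(congr1 (mulmx U^H)).
rewrite mulmxA UU mul1mx mulmx0 => /matrixP /(_ 0 0) /eqP.
by rewrite !mxE eqxx oner_eq0.
Qed.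

Lemma minor3_independent (psi : 'I_3 -> 'cV[C]_N) : minor3 psi != 0 -> independent psi.
Proof.
move=> m0; pose B : 'M[C]_3 := \matrix_(i < 3, j < 3) psi i (low j) 0.
have uB : B \in unitmx by rewrite unitmxE unitfE.
(* The dual family is read off the inverse of the minor and supported on the first three
   coordinates. *)
exists (fun i => \sum_m ((invmx B) m i)^* *: delta_mx (low m) 0) => i j.
rewrite mulmx_sumr summxE.
transitivity (((B *m invmx B) j i)^*); last first.
  by rewrite mulmxV // mxE eq_sym; case: eqP => _; rewrite ?conjC1 ?conjC0.
rewrite [in RHS]mxE conjC_sum; apply: eq_bigr => m _.
by rewrite conjCM -scalemxAr mxE -colE mxE adjmxE [B j m]mxE mulrC.
Qed.

Lemma size_roots_le (q : {poly C}) K (s : seq nat) : q != 0 -> (size q <= K.+1)%N -> uniq s ->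
  (forall n, n \in s -> root q (cayley C n)) -> (size s <= K)%N.
Proof.
move=> q0 sq us sroot; rewrite -(size_map (cayley C)) -ltnS (leq_trans _ sq) //.
apply: max_poly_roots => //; last by rewrite map_inj_uniq //; exact: cayley_inj.
by apply/allP => z /mapP [n ns ->]; exact: sroot.
Qed.

Lemma nu_fin : (nu setT < +oo)%E.
Proof. by rewrite nu_setT ltry. Qed.

Lemma dependent_null : nu dependent = 0%E.
Proof.
have mD := dependent_measurable.
apply: (null_of_finite_overlap (K := 27) nu_fin mD (measurable_act _ _ _)
  (fun n => act_preserving (spike 0) (spike 1) (spike 2) n mD)).
move=> U [//|n0 s] us sD.
(* A single parameter [n0] with a unitary translate already shows that the original states are
   nonzero. *)
have st0 i : states U i != 0.
  have [[u1 u2 u3] _] := sD n0 (mem_head _ _).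
  have : states (act (spike 0) (spike 1) (spike 2) n0 U) i != 0.
    by have [-> | [-> | ->]] := ord3P i;
      [exact: (unitary_col_neq0 u1)|exact: (unitary_col_neq0 u2)|exact: (unitary_col_neq0 u3)].
  by rewrite states_act; apply: contra => /eqP ->; rewrite mulmx0.
apply: (size_roots_le (q := minorpoly (states U))) => //.
- exact: minorpoly_neq0.
- exact: size_minorpoly.
move=> n /sD [_ /= m0]; rewrite /root horner_minorpoly; apply/eqP; rewrite -m0.
by congr minor3; apply/funext => i; rewrite states_act.
Qed.

Variable p : 'I_3 -> R.
Hypothesis p_gt0 : forall i, 0 < p i.

(** Phrased by vectors rather than measurements, which makes it measurable; outside the zero set of
    the minor the states are independent, so the stationary family is unique up to scalars. *)
Definition product_optimum := [set U : X |
    exists phi, stationary p (states U) phi /\ exists a, \det (unvec (phi a)) = 0]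
  `&` ~` [set U | minor3 (states U) = 0].

Lemma product_optimum_measurable : measurable product_optimum.
Proof.
apply: measurableI; last by apply: measurableC; exact: minor3_zero_measurable.
by apply: measurable_stationary => i; exact: states_measurable.
Qed.

Lemma product_optimum_null : nu product_optimum = 0%E.
Proof.
have mE := product_optimum_measurable.
pose T n : 'M[C]_N := twist corner (cayley C n).
have TT n : (T n)^H *m T n = 1%:M by exact: twist_adj.
(* 39 = 3 * 13: at most 13 parameters for each of the three vectors. *)
apply: (null_of_finite_overlap (K := 39) nu_fin mE (measurable_act _ _ _)
  (fun n => act_preserving corner corner corner n mE)).
move=> U [//|n0 s] us sE.
have actE n : states (act corner corner corner n U) = fun i => T n *m states U i.
  by apply/funext => i; exact: (states_act (fun=> corner)).
have back n phi : stationary p (states (act corner corner corner n U)) phi ->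
    stationary p (states U) (fun i => (T n)^H *m phi i).
  rewrite actE => /(stationary_unitary (T := (T n)^H)).
  rewrite adjmxK (mulmx1C (TT n)) => /(_ erefl); congr stationary.
  by apply/funext => i; rewrite mulmxA TT mul1mx.
(* The first parameter [n0] provides the reference family [phi] for [U]; the families of all other
   parameters, pulled back to [U], are compared with it. *)
have [[phi0 [st0 _]] /eqP m0] := sE n0 (mem_head _ _).
pose phi i := (T n0)^H *m phi0 i.
have st : stationary p (states U) phi by exact: back.
have [x xd] : independent (states U).
  have [x xd] := minor3_independent m0.
  exists (fun i => (T n0)^H *m x i) => i j; rewrite -xd actE.
  by rewrite adjmxM mulmxA.
have phi_neq0 i : phi i != 0.
  apply/eqP => phi_i; have := stationary_neq0 p_gt0 xd i st.
  by rewrite phi_i mulmx0 mxE ltxx.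
apply: (size_roots_le (q := detpoly (phi 0) * detpoly (phi 1) * detpoly (phi 2))) => //.
- by rewrite !mulf_neq0 // detpoly_neq0.
- apply: (@size_mul_le _ _ _ 26 13); last exact: size_detpoly.
  by apply: (@size_mul_le _ _ _ 13 13); exact: size_detpoly.
move=> n /sE [[phin [stn [a da]]] _].
(* By uniqueness the product vector found at parameter [n] is a multiple of [T n *m phi a], so
   [cayley C n] is a root of [detpoly (phi a)]. *)
have [c c0 cE] := stationary_unique p_gt0 xd st (back _ _ stn) a.
have phinE : phin a = c *: (T n *m phi a).
  by rewrite scalemxAr -cE mulmxA (mulmx1C (TT n)) mul1mx.
have r : root (detpoly (phi a)) (cayley C n).
  apply/eqP; rewrite horner_detpoly -/(T n).
  apply: (mulfI (expf_neq0 2 c0)); rewrite mulr0 -detZ -da phinE; congr (\det _).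
  by apply/matrixP => i j; rewrite !mxE.
rewrite !rootM; have [e | [e | e]] := ord3P a; rewrite e in r; apply/orP.
- by left; apply/orP; left; exact: r.
- by left; apply/orP; right; exact: r.
- by right; exact: r.
Qed.

End HaarTriples.

Theorem theorem1 (R : realType) (p : 'I_3 -> R)
    (p_pos : forall i, 0 < p i) (p_sum : \sum_(i < 3) p i = 1)
    (mu : probability (CMat R) R) (mu_haar : haar_measure mu) :
  {ae ((mu \x mu) \x mu)%E, forall U : (CMat R * CMat R) * CMat R,
    let psi : 'I_3 -> 'cV[R[i]]_(2 * 2) :=
      [ffun i : 'I_3 => [:: U.1.1; U.1.2; U.2]`_i *m ket00 R] in
    ~ (exists Pi : 'I_3 -> 'M[R[i]]_(2 * 2),
         is_locc Pi /\ attains_optimum p psi Pi)}.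
Proof.
have nD := dependent_null mu_haar; have nE := product_optimum_null mu_haar p_pos.
have mD := @dependent_measurable R; have mE := product_optimum_measurable p.
have neg := negligibleU (negligibleU (negligible_nonunitary mu_haar)
  (iffRL (negligibleP _ mD) nD)) (iffRL (negligibleP _ mE) nE).
(* A triple with an optimal LOCC measurement is shown to lie in one of three null sets: the
   non-unitary triples, [dependent], or [product_optimum]. *)
apply: negligibleS neg => U /= /contrapT [Pi [[t [wf tPi]] opt]].
case: (pselect (all_unitary U)) => [uU|]; last by left; left.
case: (pselect (minor3 (states U) = 0)) => [m0|m0]; first by left; right.
right; split=> //=.
have psiE : [ffun i : 'I_3 => [:: U.1.1; U.1.2; U.2]`_i *m ket00 R] = states U :> ('I_3 -> _).
  by apply/funext => i; rewrite ffunE.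
rewrite psiE in opt.
have ind : independent (states U) by apply: minor3_independent; exact/eqP.
have [st disc] := optimum_stationary p_pos ind opt.
exists (fun i => Pi i *m states U i); split=> //.
have [x xd] := ind.
apply: (locc_discriminates_product wf) => [a|a o oa].
  by apply/eqP => phi0; have := stationary_neq0 p_pos xd a st; rewrite phi0 mulmx0 mxE ltxx.
by rewrite tPi disc.
Qed.
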